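(* In the pseudo-Euclidean space $\mathbf{E}^{k,l}$, consider a line $\ell$ intersecting the ellipsoid $\mathcal{E}=\mathcal{Q}_0$. Then this line is touching $d-1$ quadrics from the confocal family $(\mathcal{Q}_\lambda)$. If we denote their parameters by $\alpha_1,\dots,\alpha_{d-1}$ (suitably numbered) and take $$\{b_1,\dots,b_p,c_1,\dots,c_q\}=\{\varepsilon_1a_1,\dots,\varepsilon_da_d,\alpha_1,\dots,\alpha_{d-1}\}$$ (equality of multisets) with $$c_q\le\dots\le c_2\le c_1<0<b_1\le b_2\le\dots\le b_p,\qquad p+q=2d-1,$$ then additionally: \begin{itemize} \item if $\ell$ is space-like, then $p=2k-1$, $q=2l$, $a_1=b_p$, $\alpha_i\in\{b_{2i-1},b_{2i}\}$ for $1\le i\le k-1$, and $\alpha_{j+k-1}\in\{c_{2j-1},c_{2j}\}$ for $1\le j\le l$; \item if $\ell$ is time-like, then $p=2k$, $q=2l-1$, $c_q=-a_d$, $\alpha_i\in\{b_{2i-1},b_{2i}\}$ for $1\le i\le k$, and $\alpha_{j+k}\in\{c_{2j-1},c_{2j}\}$ for $1\le j\le l-1$; \item if $\ell$ is light-like, then $p=2k$, $q=2l-1$, $b_p=\infty=\alpha_k$, $b_{p-1}=a_1$, $\alpha_i\in\{b_{2i-1},b_{2i}\}$ for $1\le i\le k-1$, and $\alpha_{j+k}\in\{c_{2j-1},c_{2j}\}$ for $1\le j\le l-1$. \end{itemize} Moreover, for each point on $\ell$ inside $\mathcal{E}$, there are exactly $d$ distinct quadrics from the confocal family containing it. More precisely,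 there is exactly one parameter of these quadrics in each of the intervals $$(c_{2l-1},c_{2l-2}),\ \dots,\ (c_3,c_2),\ (c_1,0),\ (0,b_1),\ (b_2,b_3),\ \dots,\ (b_{2k-2},b_{2k-1}).$$
   Context: Let $k,l\ge 1$ and $d=k+l$. The pseudo-Euclidean space $\mathbf{E}^{k,l}$ is $\mathbf{R}^d$ with the scalar product $\langle x,y\rangle_{k,l}=x_1y_1+\dots+x_ky_k-x_{k+1}y_{k+1}-\dots-x_dy_d$; $\circ$ denotes the standard Euclidean product. A line with direction vector $v$ is space-like, time-like or light-like if $\langle v,v\rangle_{k,l}$ is $>0$, $<0$ or $=0$ respectively. Put $\varepsilon_i=1$ for $1\le i\le k$ and $\varepsilon_i=-1$ for $k+1\le i\le d$. Fix positive constants $a_1,\dots,a_d$ with $a_1>a_2>\dots>a_k>0>-a_{k+1}>\dots>-a_d$. The confocal family is $$\mathcal{Q}_\lambda:\ \sum_{i=1}^d\frac{x_i^2}{a_i-\varepsilon_i\lambda}=1,\qquad\lambda\in\mathbf{R},$$ and $\mathcal{E}=\mathcal{Q}_0$ is the ellipsoid $\sum_i x_i^2/a_i=1$; a point $x$ is inside $\mathcal{E}$ if $\sum_i x_i^2/a_i<1$. For $\lambda=\varepsilon_ia_i$ the quadric $\mathcal{Q}_\lambda$ is degenerate and is understood as the coordinate hyperplane $x_i=0$; the hyperplane at infinity is added to the family as $\mathcal{Q}_\infty$. The parameters of the quadrics containing a point $x$ are the solutions $\lambda$ of $\sum_i x_i^2/(a_i-\varepsilon_i\lambda)=1$, i.e.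 the roots of the polynomial obtained by clearing denominators. With $A_\lambda=\mathrm{diag}\left(\frac1{a_1-\varepsilon_1\lambda},\dots,\frac1{a_d-\varepsilon_d\lambda}\right)$, the line $x+tv$ ($t\in\mathbf{R}$) is tangent to (touches) $\mathcal{Q}_\lambda$ if $A_\lambda(x+tv)\circ(x+tv)=1$ has a double root in $t$, i.e. if $$(A_\lambda x\circ v)^2-(A_\lambda v\circ v)(A_\lambda x\circ x-1)=0.$$ The left-hand side equals $\mathcal{P}(\lambda)/\prod_{i=1}^d(a_i-\varepsilon_i\lambda)$ for a polynomial $\mathcal{P}$ of degree at most $d-1$, of degree exactly $d-1$ if the line is not light-like. The parameters of the quadrics touched by the line are the roots of $\mathcal{P}$, counted with multiplicity, where $\mathcal{P}$ is always regarded as having degree $d-1$, missing roots (for light-like lines) being equal to $\infty$; thus light-like lines are regarded as tangent to $\mathcal{Q}_\infty$. The value $\infty$ is counted as larger than every real number.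
   Formalization: Lines tangent to E are excluded; inside E each interval's closure holds one parameter (with multiplicity); d distinct quadrics are claimed only if no ε_i a_i is a multiple root, and one parameter per open interval only if none equals a b or c. As printed the claim fails at such points. *)

(* Defs.v *)
From HB Require Import structures.
From mathcomp Require Import all_boot all_order all_algebra.
From mathcomp Require Import reals constructive_ereal.
From mathcomp Require Import ring.

Set Implicit Arguments.
Unset Strict Implicit.
Unset Printing Implicit Defensive.

Import Order.TTheory GRing.Theory Num.Theory.
Local Open Scope ring_scope.

(* Coordinates are numbered from 0: x_1, ..., x_k are those of index i < k. *)
Definition eps (R : realType) (k l : nat) (i : 'I_(k + l)) : R :=
  if (i < k)%N then 1 else -1.

Definition dot (R : realType) (n : nat) (u w : 'cV[R]_n) : R :=
  (u^T *m w) 0 0.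

Definition pseudo_dot (R : realType) (k l : nat) (u w : 'cV[R]_(k + l)) : R :=
  \sum_i eps R i * u i 0 * w i 0.

Definition space_like (R : realType) (k l : nat) (v : 'cV[R]_(k + l)) : Prop :=
  0 < pseudo_dot v v.
Definition time_like (R : realType) (k l : nat) (v : 'cV[R]_(k + l)) : Prop :=
  pseudo_dot v v < 0.
Definition light_like (R : realType) (k l : nat) (v : 'cV[R]_(k + l)) : Prop :=
  pseudo_dot v v = 0.

(* a_1 > ... > a_k > 0 > - a_{k+1} > ... > - a_d *)
Definition confocal_constants (R : realType) (k l : nat)
    (a : 'I_(k + l) -> R) : Prop :=
  (forall i, 0 < a i) /\
  (forall i j : 'I_(k + l), (i < j)%N -> eps R j * a j < eps R i * a i).

Definition conf_mx (R : realType) (k l : nat) (a : 'I_(k + l) -> R) (lam : R)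
    : 'M[R]_(k + l) :=
  diag_mx (\row_i (a i - eps R i * lam)^-1).

Definition on_ellipsoid (R : realType) (k l : nat) (a : 'I_(k + l) -> R)
    (x : 'cV[R]_(k + l)) : Prop :=
  dot (conf_mx a 0 *m x) x = 1.

Definition inside_ellipsoid (R : realType) (k l : nat) (a : 'I_(k + l) -> R)
    (x : 'cV[R]_(k + l)) : Prop :=
  dot (conf_mx a 0 *m x) x < 1.

(* A quarter of the discriminant of the quadratic polynomial
   A_lam (x + t v) . (x + t v) - 1 in t. *)
Definition tangency_disc (R : realType) (k l : nat) (a : 'I_(k + l) -> R)
    (x v : 'cV[R]_(k + l)) (lam : R) : R :=
  let A := conf_mx a lam in
  dot (A *m x) v ^+ 2 - dot (A *m v) v * (dot (A *m x) x - 1).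

(* A line that meets the ellipsoid without touching it.  Tangent lines have to
   be excluded: for them 0 is one of the touched parameters, and a light-like
   tangent line may touch every quadric of the family. *)
Definition intersects_ellipsoid (R : realType) (k l : nat)
    (a : 'I_(k + l) -> R) (x v : 'cV[R]_(k + l)) : Prop :=
  (exists t : R, on_ellipsoid a (x + t *: v)) /\ tangency_disc a x v 0 != 0.

Definition denom (R : realType) (k l : nat) (a : 'I_(k + l) -> R)
    (i : 'I_(k + l)) : {poly R} :=
  (a i)%:P - eps R i *: 'X.

(* The roots of this polynomial are the parameters of the quadrics containing
   x; it has the root eps_i a_i exactly when x lies in the hyperplane x_i = 0,
   which is the degenerate quadric of that parameter (see containing_polyE and
   containing_poly_degenerate). *)
Definition containing_poly (R : realType) (k l : nat) (a : 'I_(k + l) -> R)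
    (x : 'cV[R]_(k + l)) : {poly R} :=
  \sum_i x i 0 ^+ 2 *: \prod_(j | j != i) denom a j - \prod_j denom a j.

(* The polynomial P such that tangency_disc = P / \prod_i (a_i - eps_i lam),
   written out with Lagrange's identity; see tangency_polyE. *)
Definition tangency_poly (R : realType) (k l : nat) (a : 'I_(k + l) -> R)
    (x v : 'cV[R]_(k + l)) : {poly R} :=
  \sum_i v i 0 ^+ 2 *: \prod_(j | j != i) denom a j
  - \sum_(i < k + l) \sum_(j < k + l | (i < j)%N)
      (x i 0 * v j 0 - x j 0 * v i 0) ^+ 2
      *: \prod_(m | (m != i) && (m != j)) denom a m.

(* s lists, with multiplicities and in some order, the parameters of the
   quadrics touched by the line x + t v: tangency_poly splits over R, and its
   roots are completed by +oo up to the formal degree k + l - 1. *)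
Definition touched_parameters (R : realType) (k l : nat)
    (a : 'I_(k + l) -> R) (x v : 'cV[R]_(k + l)) (s : seq (\bar R)) : Prop :=
  let P := tangency_poly a x v in
  exists r : seq R,
    [/\ P != 0,
        P = lead_coef P *: \prod_(z <- r) ('X - z%:P) &
        perm_eq s ([seq z%:E | z <- r]
                     ++ nseq ((k + l).-1 - size r) (+oo)%E)].

(* The n-th element of s, numbered from 1. *)
Definition elt (R : realType) (s : seq (\bar R)) (n : nat) : \bar R :=
  nth 0%E s n.-1.

(* The end points of
   (c_{2l-1}, c_{2l-2}), ..., (c_3, c_2), (c_1, 0), (0, b_1),
   (b_2, b_3), ..., (b_{2k-2}, b_{2k-1}), in this order. *)
Definition intervals (R : realType) (k l : nat) (b c : seq (\bar R))
    : seq (\bar R * \bar R) :=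
  [seq (elt c (2 * j).+1, elt c (2 * j)%N) | j <- rev (iota 1 l.-1)]
  ++ [:: (elt c 1, 0%E); (0%E, elt b 1)]
  ++ [seq (elt b (2 * i)%N, elt b (2 * i).+1) | i <- iota 1 k.-1].

Lemma conf_dotE (R : realType) (k l : nat) (a : 'I_(k + l) -> R) (lam : R)
    (u w : 'cV[R]_(k + l)) :
  dot (conf_mx a lam *m u) w
  = \sum_i u i 0 * w i 0 / (a i - eps R i * lam).
Proof.
rewrite /dot mxE; apply: eq_bigr => i _.
by rewrite mxE mul_diag_mx !mxE; ring.
Qed.

Lemma denomE (R : realType) (k l : nat) (a : 'I_(k + l) -> R) i lam :
  (denom a i).[lam] = a i - eps R i * lam.
Proof. by rewrite /denom !hornerE. Qed.

Lemma containing_polyE (R : realType) (k l : nat) (a : 'I_(k + l) -> R)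
    (x : 'cV[R]_(k + l)) (lam : R) :
    (forall i, a i - eps R i * lam != 0) ->
  dot (conf_mx a lam *m x) x - 1
  = (containing_poly a x).[lam] / \prod_i (a i - eps R i * lam).
Proof.
move=> a0; have D0 : \prod_i (a i - eps R i * lam) != 0.
  by apply/prodf_neq0 => i _.
apply: (canRL (mulfK D0)).
rewrite conf_dotE /containing_poly !hornerE horner_prod mulrBl mul1r; congr (_ - _).
  rewrite horner_sum mulr_suml; apply: eq_bigr => i _.
  rewrite hornerZ horner_prod (bigD1 i) //= mulrA divfK // expr2.
  by under [in RHS]eq_bigr do rewrite denomE.
by apply: eq_bigr => i _; rewrite denomE.
Qed.

Lemma containing_poly_degenerate (R : realType) (k l : nat)
    (a : 'I_(k + l) -> R) (x : 'cV[R]_(k + l)) (i : 'I_(k + l)) :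
    confocal_constants a ->
  root (containing_poly a x) (eps R i * a i) = (x i 0 == 0).
Proof.
case=> _ amono; have e2 (j : 'I_(k + l)) : eps R j * eps R j = 1.
  by rewrite /eps; case: ifP => _; rewrite ?mulrNN mulr1.
have e0 (j : 'I_(k + l)) : (denom a j).[eps R i * a i] == 0 -> j = i.
  move=> d0; apply/eqP/negPn; rewrite neq_ltn; apply/negP => ji.
  have : eps R j * a j = eps R i * a i.
    move: d0; rewrite denomE subr_eq0 => /eqP ->.
    by rewrite mulrA e2 mul1r.
  by case/orP: ji => /amono + E; rewrite E ltxx.
have di : (denom a i).[eps R i * a i] = 0 by rewrite denomE mulrA e2 mul1r subrr.
rewrite rootE /containing_poly !hornerE horner_sum horner_prod.
rewrite [X in X - _](bigD1 i) //= [X in _ + X - _]big1 ?addr0 => [|j ji].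
  rewrite [X in _ - X](bigD1 i) //= di mul0r subr0 hornerZ mulf_eq0 sqrf_eq0.
  rewrite [X in _ || X]negbTE ?orbF // horner_prod.
  by apply/prodf_neq0 => j ji; apply: contra ji => /e0/eqP.
by rewrite hornerZ horner_prod (bigD1 i) 1?eq_sym //= di mul0r mulr0.
Qed.

Lemma tangency_polyE (R : realType) (k l : nat) (a : 'I_(k + l) -> R)
    (x v : 'cV[R]_(k + l)) (lam : R) :
    (forall i, a i - eps R i * lam != 0) ->
  tangency_disc a x v lam
  = (tangency_poly a x v).[lam] / \prod_i (a i - eps R i * lam).
Proof.
move=> a0; have D0 : \prod_i (a i - eps R i * lam) != 0.
  by apply/prodf_neq0 => i _.
set D := \prod_i _ in D0 *; pose g i := (a i - eps R i * lam)^-1.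
have P1 i : (\prod_(j | j != i) denom a j).[lam] = g i * D.
  rewrite horner_prod /D [in RHS](bigD1 i) //= /g mulKf //.
  by apply: eq_bigr => j _; rewrite denomE.
have P2 (i j : 'I_(k + l)) : (i < j)%N ->
    (\prod_(m | (m != i) && (m != j)) denom a m).[lam] = g i * g j * D.
  move=> ij; have ji : j != i by rewrite neq_ltn ij orbT.
  rewrite horner_prod /D [in RHS](bigD1 i) //= [in RHS](bigD1 j) //= mulrACA.
  rewrite /g mulVf // mul1r mulKf //.
  by apply: eq_bigr => m _; rewrite denomE.
apply: (canRL (mulfK D0)); rewrite /tangency_disc !conf_dotE /tangency_poly.
rewrite !hornerE !horner_sum.
under [in RHS]eq_bigr do rewrite hornerZ P1.
under [X in _ = _ - X]eq_bigr => i _.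
  rewrite horner_sum.
  under eq_bigr => j ij do rewrite hornerZ (P2 _ _ ij).
  over.
have lagrange :
  (\sum_i x i 0 * v i 0 * g i) ^+ 2
    - (\sum_i v i 0 * v i 0 * g i) * (\sum_i x i 0 * x i 0 * g i)
  = - \sum_(i < k + l) \sum_(j < k + l | (i < j)%N)
        (x i 0 * v j 0 - x j 0 * v i 0) ^+ 2 * (g i * g j).
  pose h i j := x i 0 * v i 0 * g i * (x j 0 * v j 0 * g j)
                - v i 0 * v i 0 * g i * (x j 0 * x j 0 * g j).
  transitivity (\sum_i \sum_j h i j).
    rewrite expr2 !mulr_suml -sumrB; apply: eq_bigr => i _.
    by rewrite !mulr_sumr -sumrB.
  have split_h (i : 'I_(k + l)) :
      \sum_j h i j = \sum_(j < k + l | (i < j)%N) h i j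
                     + \sum_(j < k + l | (j < i)%N) h i j.
    rewrite (bigID (fun j : 'I_(k + l) => (i < j)%N)) /=; congr (_ + _).
    under eq_bigl do rewrite -leqNgt.
    rewrite (bigD1 i) //= {1}/h [X in X + _](_ : _ = 0) ?add0r; last by ring.
    by apply: eq_bigl => j; rewrite ltn_neqAle andbC.
  under eq_bigr do rewrite split_h.
  rewrite big_split /= [X in _ + X](exchange_big_dep xpredT) //= -big_split /=.
  rewrite -sumrN; apply: eq_bigr => i _.
  rewrite -big_split -sumrN; apply: eq_bigr => j _ /=; rewrite /h; ring.
rewrite mulrBr mulr1 opprB addrCA lagrange mulrDl mulNr !mulr_suml; congr (_ - _).
  by apply: eq_bigr => i _; rewrite /g; ring.
apply: eq_bigr => i _; rewrite mulr_suml; apply: eq_bigr => j _; ring.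
Qed.

Lemma size_tangency_poly (R : realType) (k l : nat) (a : 'I_(k + l) -> R)
    (x v : 'cV[R]_(k + l)) :
  (size (tangency_poly a x v) <= k + l)%N.
Proof.
have sD i : (size (denom a i) <= 2)%N.
  rewrite /denom (leq_trans (size_polyD _ _)) // geq_max.
  rewrite (leq_trans (size_polyC_leq1 _)) //= size_polyN.
  by rewrite (leq_trans (size_scale_leq _ _)) // size_polyX.
have sP (B : pred 'I_(k + l)) : (size (\prod_(j | B j) denom a j)%R <= #|B|.+1)%N.
  rewrite (leq_trans (size_poly_prod_leq _ _)) // leq_subLR addnS ltnS.
  rewrite -sum1_card -big_split /=.
  exact: leq_sum.
have sC i : #|[pred j : 'I_(k + l) | j != i]|.+1 = (k + l)%N.
  have := cardC1 i; rewrite card_ord => ->.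
  by rewrite prednK // (leq_ltn_trans _ (ltn_ord i)).
have size_sum (I : finType) (Q : pred I) (F : I -> {poly R}) n :
    (forall i, Q i -> (size (F i) <= n)%N) ->
    (size (\sum_(i | Q i) F i)%R <= n)%N.
  move=> H; elim/big_ind: _ => //; first by rewrite size_poly0.
  by move=> p q Hp Hq; rewrite (leq_trans (size_polyD _ _)) // geq_max Hp.
rewrite /tangency_poly (leq_trans (size_polyD _ _)) // size_polyN geq_max.
apply/andP; split.
  apply: size_sum => i _; rewrite (leq_trans (size_scale_leq _ _)) //.
  by rewrite (leq_trans (sP _)) // sC.
apply: (size_sum) => i _; apply: size_sum => j ij.
rewrite (leq_trans (size_scale_leq _ _)) // (leq_trans (sP _)) //.
rewrite -[leqRHS](sC i) ltnS subset_leq_card //.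
by apply/subsetP => m; rewrite !inE => /andP[].
Qed.

(* Main.v *)
Require Import Defs.
From HB Require Import structures.
From mathcomp Require Import all_boot all_order all_algebra.
From mathcomp Require Import reals constructive_ereal.
From mathcomp Require Import polyrcf ring lra zify.

Set Implicit Arguments.
Unset Strict Implicit.
Unset Printing Implicit Defensive.

Import Order.TTheory GRing.Theory Num.Theory.
Local Open Scope ring_scope.

(* Insert 0 between the negative and the positive numbers eps_i a_i, call the
   resulting points p_0 < ... < p_d, and let H be the product of the X - p_m.
   If y lies inside the ellipsoid, the polynomial F of the parameters of the
   quadrics through y, made monic, has weakly the sign of H' at every p_m, so
   its roots lam_n satisfy p_n <= lam_n <= p_(n+1).  The tangency polynomial
   multiplied by X (up to sign) is a polynomial G with G H = B^2 - A F, where A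
   also has weakly the sign of H' at the points p_m.  Hence G H >= 0 at the
   roots of F, so that G weakly alternates in sign along the lam_n and its roots
   separate them; as the coefficient of X^d in G is - <v,v>, the type of the
   line decides whether one more root lies below all lam_n (space-like), above
   all of them (time-like) or at infinity (light-like).  Since G does not depend
   on the point of the line, both the poles and the touched parameters are
   separated by the lam_n of every inner point, which is what the pairs
   {b_(2i-1), b_2i} and the intervals between them express.  In degenerate
   positions a double root of F is one of the p_m, and the sign of G' there
   replaces the missing sign change. *)

(** * Polynomials with weakly alternating signs *)

(* lia restricted to the natural-number facts of the context: preprocessing
   the hypotheses about real polynomials is expensive. *)
Ltac nlia :=
  repeat match goal with
  | H : ?T |- _ =>
    lazymatch T with
    | nat => fail
    | is_true (leq _ _) => fail
    | is_true (andb _ _) => fail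
    | @eq nat _ _ => fail
    | is_true (negb _) => fail
    | _ => clear H
    end
  end; lia.

Lemma poly_root_between (R : rcfType) (P : {poly R}) (y z : R) :
  y <= z -> P.[y] * P.[z] < 0 -> exists2 r, y < r < z & root P r.
Proof.
by move=> yz /(poly_ivtoo yz)[r rI Pr]; exists r.
Qed.

Lemma deriv_mul_XsubC (R : comNzRingType) (Q : {poly R}) (r z : R) :
  (Q * ('X - r%:P))^`().[z] = Q^`().[z] * (z - r) + Q.[z].
Proof. by rewrite derivM derivXsubC mulr1 !hornerE. Qed.

(* When z1 is the only available root, the absence of roots in [z0, z1)
   controls the first two Taylor coefficients of Q at z1. *)
Lemma sign_change_root (R : rcfType) (P : {poly R}) (z0 z1 : R) :
    z0 <= z1 -> 0 <= P.[z0] -> P.[z1] <= 0 ->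
    (z0 = z1 -> P^`().[z0] <= 0) ->
  exists r Q, [/\ z0 <= r <= z1, P = Q * ('X - r%:P) &
    r < z1 \/ [/\ r = z1, Q.[z1] <= 0 &
                  z0 < z1 -> Q.[z1] = 0 -> 0 <= Q^`().[z1]]].
Proof.
move=> z01 P0 P1 dP; have [z0E|z0N] := eqVneq z0 z1.
  have /factor_theorem [Q PE] : root P z0.
    by rewrite rootE eq_le P0 {1}z0E P1.
  exists z0, Q; split=> //; [by rewrite lexx | right; split=> //].
    by have := dP z0E; rewrite PE deriv_mul_XsubC subrr mulr0 add0r z0E.
  by rewrite z0E ltxx.
have z0lt : z0 < z1 by rewrite lt_neqAle z0N.
have noroot_or : (exists2 r, z0 <= r < z1 & root P r)
              \/ (forall r, z0 <= r < z1 -> ~~ root P r).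
  have [->|Pn0] := eqVneq P 0.
    by left; exists z0; rewrite ?lexx // rootE horner0.
  case: (boolP (has (fun r => z0 <= r < z1) (rootsR P))) => [/hasP[r]|/hasPn h].
    by rewrite -roots_on_rootsR // => /andP[_ Pr] rI; left; exists r.
  right=> r rI; apply/negP => Pr; have := h r.
  by rewrite -roots_on_rootsR // Pr rI => /(_ isT).
case: noroot_or => [[r /andP[r0 r1] /factor_theorem[Q PE]]|nor].
  by exists r, Q; split=> //; [rewrite r0 ltW | left].
have P0' : 0 < P.[z0].
  by rewrite lt_neqAle P0 eq_sym -rootE nor // lexx.
(* Without a root of [P] in [z0, z1), no factor of [P] takes strictly opposite signs at the two
   ends. This is used for [P] itself, for its cofactor [Q] at z1, and for the cofactor of a double
   root z1. *)
have sub (Q Q' : {poly R}) : P = Q * Q' -> ~ Q.[z0] * Q.[z1] < 0.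
  move=> PE /(poly_root_between z01)[r /andP[r0 r1] Qr].
  by have := nor r; rewrite PE rootM Qr ltW ?r1 // => /(_ isT).
have /factor_theorem [Q PE] : root P z1.
  rewrite rootE; move: P1; rewrite le_eqVlt => /orP[//|P1].
  by case: (sub P 1); rewrite ?mulr1 // pmulr_rlt0.
have Q0 : Q.[z0] < 0.
  by move: P0'; rewrite PE !hornerE nmulr_lgt0 // subr_lt0.
have Q1 : Q.[z1] <= 0.
  by rewrite leNgt; apply/negP => Q1; apply: (sub _ _ PE); rewrite pmulr_llt0.
exists z1, Q; split=> //; [by rewrite z01 lexx | right; split=> // _ /eqP Q1E].
have /factor_theorem [Q2 QE] : root Q z1 by [].
rewrite QE deriv_mul_XsubC subrr mulr0 add0r leNgt; apply/negP => Q2z.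
apply: (sub Q2 (('X - z1%:P) * ('X - z1%:P))); first by rewrite PE QE mulrA.
rewrite nmulr_llt0 //.
by move: Q0; rewrite QE !hornerE nmulr_llt0 // subr_lt0.
Qed.

Definition linprod (R : nzRingType) (n : nat) (z : nat -> R) : {poly R} :=
  \prod_(i < n) ('X - (z i)%:P).

(** Induction on [n]: a root r in [z 0, z 1] is split off, and minus the cofactor satisfies the
    hypotheses at the shifted points. The sign of X - r is lost only at points equal to r, and as
    three consecutive points are never all equal, these can only be z 1 and z 2; there the Taylor
    data of [sign_change_root] and the derivative hypothesis take over. *)
Lemma weak_alternation_roots (R : rcfType) (n : nat) (P : {poly R})
    (z : nat -> R) :
    (forall i, (i < n)%N -> z i <= z i.+1) ->
    (forall i, (i.+1 < n)%N -> z i < z i.+2) ->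
    (forall i, (i <= n)%N -> 0 <= (-1) ^+ i * P.[z i]) ->
    (forall i, (i < n)%N -> z i = z i.+1 -> (-1) ^+ i * P^`().[z i] <= 0) ->
  exists r Q, (forall i, (i < n)%N -> z i <= r i <= z i.+1)
              /\ P = Q * linprod n r.
Proof.
elim: n P z => [|n IHn] P z z_le z_lt Psign Pderiv.
  by exists z, P; split=> //; rewrite /linprod big_ord0 mulr1.
have P0 : 0 <= P.[z 0] by have := Psign 0%N isT; rewrite expr0 mul1r.
have P1 : P.[z 1] <= 0 by have := Psign 1%N isT; rewrite expr1 mulN1r oppr_ge0.
have dP : z 0%N = z 1%N -> P^`().[z 0] <= 0.
  by move=> /(Pderiv 0%N isT); rewrite expr0 mul1r.
have [r [Q [r01 PE rlt]]] := sign_change_root (z_le _ (ltn0Sn _)) P0 P1 dP.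
have z_mono m i : (m <= i <= n)%N -> z m.+1 <= z i.+1.
  elim: i => [|i IHi] mi; first by have -> : m = 0%N by nlia.
  case: (ltnP i m) => im; first by have -> : m = i.+1 by nlia.
  by apply: le_trans (IHi _) (z_le _ _); nlia.
(* The two sign conditions at a double point are opposite, so [P] vanishes there. *)
have z_double i : (i < n)%N -> z i.+1 = z i.+2 -> P.[z i.+1] = 0.
  move=> lt_in zE; have := Psign i.+1 (ltnW lt_in); have := Psign i.+2 lt_in.
  rewrite -zE [_ ^+ i.+2]exprS mulN1r mulNr oppr_ge0 => h1 h2.
  have /eqP : (-1) ^+ i.+1 * P.[z i.+1] = 0 by apply/eqP; rewrite eq_le h1.
  by rewrite mulf_eq0 signr_eq0 => /eqP.
have Qsign i : (i <= n)%N -> r < z i.+1 -> 0 <= (-1) ^+ i.+1 * Q.[z i.+1].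
  move=> le_in ri; have := Psign i.+1 le_in; rewrite PE hornerM hornerXsubC mulrA.
  by rewrite pmulr_lge0 // subr_gt0.
(* To the right of r, [Q] vanishes at a double point together with [P], so that P' = Q' (X - r)
   there. *)
have Qderiv i : (i < n)%N -> r < z i.+1 -> z i.+1 = z i.+2 ->
    (-1) ^+ i.+1 * Q^`().[z i.+1] <= 0.
  move=> lt_in ri zE; have := Pderiv i.+1 lt_in zE.
  rewrite PE deriv_mul_XsubC.
  have /eqP := z_double i lt_in zE; rewrite PE hornerM hornerXsubC mulf_eq0.
  rewrite [_ - _ == 0]gt_eqF ?subr_gt0 // orbF => /eqP ->.
  by rewrite addr0 mulrA pmulr_lle0 // subr_gt0.
have [] := IHn (- Q) (fun i => z i.+1).
- by move=> i lt_in; exact: (z_le i.+1 lt_in).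
- by move=> i lt_in; exact: (z_lt i.+1 lt_in).
- move=> i le_in; rewrite hornerN mulrN -mulNr -mulN1r -exprS.
  have [|le_zr] := ltP r (z i.+1); first exact: Qsign.
  case: rlt => [rlt|[rE Q1 dQ1]].
    by have := lt_le_trans rlt (z_mono 0%N i le_in); rewrite ltNge le_zr.
  (* Now r = z 1, and z 1, ..., z (i+1) coincide, so i is 0 or 1. For i = 0 the sign of Q(z 1) is
     known; for i = 1 it comes from P'(z 1) = Q(z 1). *)
  have z1i : z 1%N = z i.+1 by apply/eqP; rewrite eq_le (z_mono 0%N _ le_in) -rE.
  case: i le_in le_zr z1i => [|i] le_in le_zr z1i.
    by rewrite expr1 mulN1r oppr_ge0.
  case: i le_in le_zr z1i => [|i] le_in le_zr z1i; last first.
    suff: z 1%N < z i.+3 by rewrite z1i ltxx.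
    by apply: lt_le_trans (z_lt 1%N _) (z_mono 2%N _ _); nlia.
  rewrite sqrrN expr1n mul1r -z1i.
  have := Pderiv 1%N le_in z1i; rewrite expr1 mulN1r oppr_le0 PE.
  by rewrite deriv_mul_XsubC rE subrr mulr0 add0r.
- move=> i lt_in zE; rewrite derivN hornerN mulrN -mulNr -mulN1r -exprS.
  have [ri|le_zr] := ltP r (z i.+1); first exact: Qderiv.
  case: rlt => [rlt|[rE Q1 dQ1]].
    by have := lt_le_trans rlt (z_mono 0%N i (ltnW lt_in)); rewrite ltNge le_zr.
  have z1i : z 1%N = z i.+1 by
    apply/eqP; rewrite eq_le (z_mono 0%N _ (ltnW lt_in)) -rE.
  case: i lt_in le_zr z1i zE => [|i] lt_in le_zr z1i zE; last first.
    suff: z 1%N < z i.+3 by rewrite z1i zE ltxx.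
    by apply: lt_le_trans (z_lt 1%N _) (z_mono 2%N _ _); nlia.
  (* Only z 1 = z 2 = r is left. Here z 0 < z 2 = z 1, and the two sign conditions on Q(z 1) force
     it to be 0, so the last clause of [sign_change_root] applies. *)
  rewrite expr1 mulN1r oppr_le0; apply: dQ1; first by rewrite zE z_lt.
  have := Pderiv 1%N lt_in zE; rewrite expr1 mulN1r oppr_le0 PE.
  rewrite deriv_mul_XsubC rE subrr mulr0 add0r => Q1'.
  by apply/eqP; rewrite eq_le Q1 Q1'.
move=> r' [Q' [r'I QE]].
exists (fun i => if i is j.+1 then r' j else r), (- Q').
split; first by case=> [|i] //= lt_in; exact: r'I.
rewrite /linprod big_ord_recl /= PE -[Q]opprK QE /linprod; ring.
Qed.

Lemma monic_linprod (R : nzRingType) n (z : nat -> R) : linprod n z \is monic.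
Proof. exact: monic_prod_XsubC. Qed.

Lemma size_linprod (R : nzRingType) n (z : nat -> R) :
  size (linprod n z) = n.+1.
Proof. by rewrite /linprod size_prod_XsubC /index_enum -enumT size_enum_ord. Qed.

Lemma horner_linprod (R : comNzRingType) n (z : nat -> R) x :
  (linprod n z).[x] = \prod_(i < n) (x - z i).
Proof. by rewrite horner_prod; apply: eq_bigr => i _; rewrite hornerXsubC. Qed.

Lemma linprod_bump (R : comNzRingType) n (z : nat -> R) m : (m < n)%N ->
  linprod n z = ('X - (z m)%:P) * linprod n.-1 (fun i => z (bump m i)).
Proof.
by case: n => // n lt_mn; rewrite /linprod (@bigD1_ord _ _ _ _ (Ordinal lt_mn)).
Qed.

Lemma root_linprod (R : idomainType) n (z : nat -> R) x :
  reflect (exists2 i, (i < n)%N & x = z i) (root (linprod n z) x).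
Proof.
rewrite rootE horner_linprod; apply: (iffP (prodf_eq0 _ _)) => /=.
  by case=> i _; rewrite subr_eq0 => /eqP ->; exists i.
by case=> i lt_in ->; exists (Ordinal lt_in); rewrite ?subrr.
Qed.

Lemma linprodE (R : nzRingType) n (z : nat -> R) :
  linprod n z = \prod_(y <- mkseq z n) ('X - y%:P).
Proof.
by rewrite /linprod /mkseq big_map -(big_mkord xpredT (fun i => 'X - (z i)%:P))
  /index_iota subn0.
Qed.

(** The n - m factors with x <= z i are the non-positive ones, and n + m has the parity of n - m. *)
Lemma sign_linprod (R : realDomainType) n m (z : nat -> R) x : (m <= n)%N ->
    (forall i, (i < m)%N -> z i <= x) ->
    (forall i, (m <= i < n)%N -> x <= z i) ->
  0 <= (-1) ^+ (n + m) * (linprod n z).[x].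
Proof.
rewrite horner_linprod; elim: n => [|n IHn] le_mn zx xz.
  have -> : m = 0%N by nlia.
  by rewrite addn0 expr0 big_ord0 mulr1.
rewrite big_ord_recr /=; case: (ltnP n m) => [lt_nm|le_mn'].
  have mE : m = n.+1 by nlia.
  rewrite mE exprD -expr2 sqrr_sign mul1r mulr_ge0 //.
    by apply: prodr_ge0 => i _; rewrite subr_ge0 zx // mE ltnW // ltnS.
  by rewrite subr_ge0 zx // mE.
have -> (P y : R) : (-1) ^+ (n.+1 + m) * (P * y) = (-1) ^+ (n + m) * P * - y.
  by rewrite addSn exprS; ring.
rewrite mulr_ge0 //; last by rewrite opprB subr_ge0 xz //; nlia.
by apply: IHn => // i iI; apply: xz; nlia.
Qed.

Lemma split_linprod (R : idomainType) n (P Q : {poly R}) (r : nat -> R) :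
  P = Q * linprod n r -> (size P <= n.+1)%N -> P = lead_coef P *: linprod n r.
Proof.
have [-> ->|Q0 PE] := eqVneq Q 0; first by rewrite mul0r lead_coef0 scale0r.
rewrite {1}PE size_Mmonic ?monic_linprod // size_linprod addnS /= => sQ.
have /size_poly1P[c _ QE] : size Q == 1%N.
  by rewrite eqn_leq lt0n size_poly_eq0 Q0 andbT -(leq_add2r n) add1n.
by rewrite PE QE mul_polyC lead_coefZ (monicP (monic_linprod _ _)) mulr1.
Qed.

(** The factor (-1)^d makes the alternation start with a plus sign. At distinct points the
    derivative condition of [weak_alternation_roots] is vacuous, and the degree leaves only a
    constant cofactor. *)
Lemma alternating_roots (R : rcfType) d (p : nat -> R) (F : {poly R}) :
    (forall i, (i < d)%N -> p i < p i.+1) -> F \is monic -> size F = d.+1 ->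
    (forall m, (m <= d)%N -> 0 <= (-1) ^+ (d + m) * F.[p m]) ->
  exists2 lam, (forall n, (n < d)%N -> p n <= lam n <= p n.+1)
             & F = linprod d lam.
Proof.
move=> p_lt monF sF Fsign.
have [|||| lam [Q [lamI FE]]] := @weak_alternation_roots _ d ((-1) ^+ d *: F) p.
- by move=> i lt_id; rewrite ltW ?p_lt.
- by move=> i lt_id; apply: lt_trans (p_lt i _) (p_lt _ _); nlia.
- by move=> i le_id; rewrite hornerZ mulrA -exprD addnC Fsign.
- by move=> i lt_id pE; have := p_lt i lt_id; rewrite pE ltxx.
exists lam => //.
have {}FE : F = ((-1) ^+ d *: Q) * linprod d lam.
  by rewrite -scalerAl -FE scalerA -expr2 sqrr_sign scale1r.
by have := split_linprod FE; rewrite sF (monicP monF) scale1r => ->.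
Qed.

(** The form needed for the tangency polynomial: [e] sets the starting sign, the roots come as a
    sorted list, and each root is compared with all the points and not only with its two
    neighbours. *)
Lemma weak_alternation_seq (R : rcfType) n e (P : {poly R}) (z : nat -> R) :
    (forall i, (i < n)%N -> z i <= z i.+1) ->
    (forall i, (i.+1 < n)%N -> z i < z i.+2) ->
    (forall i, (i <= n)%N -> 0 <= (-1) ^+ (e + i) * P.[z i]) ->
    (forall i, (i < n)%N -> z i = z i.+1 ->
       (-1) ^+ (e + i) * P^`().[z i] <= 0) ->
    (size P <= n.+1)%N ->
  exists s, [/\ sorted <=%R s, size s = n,
    P = lead_coef P *: \prod_(y <- s) ('X - y%:P) &
    forall i j, (i <= n)%N -> (j < n)%N ->
      ((i <= j)%N -> z i <= s`_j) /\ ((j < i)%N -> s`_j <= z i)].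
Proof.
move=> z_le z_lt Psign Pderiv sP.
have [|i lt_in zE|r [Q [rI PE]]] :=
  @weak_alternation_roots _ n ((-1) ^+ e *: P) z z_le z_lt.
- by move=> i le_in; rewrite hornerZ mulrA -exprD addnC Psign.
- by rewrite derivZ hornerZ mulrA -exprD addnC Pderiv.
have {}PE : P = ((-1) ^+ e *: Q) * linprod n r.
  by rewrite -scalerAl -PE scalerA -expr2 sqrr_sign scale1r.
have z_mono i j : (i <= j <= n)%N -> z i <= z j.
  elim: j => [|j IHj] ij; first by have -> : i = 0%N by nlia.
  have [->|ij'] := eqVneq i j.+1; first by [].
  have /IHj h0 : (i <= j <= n)%N by nlia.
  by apply: le_trans h0 (z_le _ _); nlia.
exists (mkseq r n); split; rewrite ?size_mkseq //.
- apply/(sortedP 0) => i; rewrite size_mkseq => lt_in.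
  have [_ h1] := andP (rI i (ltnW lt_in)); have [h2 _] := andP (rI _ lt_in).
  by rewrite !nth_mkseq // ?(ltnW lt_in) // (le_trans h1).
- by rewrite -linprodE; apply: split_linprod PE sP.
move=> i j le_in lt_jn; rewrite nth_mkseq //; have [h1 h2] := andP (rI j lt_jn).
split=> ij; first by apply: le_trans (z_mono _ _ _) h1; nlia.
by apply: le_trans h2 (z_mono _ _ _); nlia.
Qed.

(** This and its counterpart at minus infinity supply one more alternation point beyond the given
    ones, from the sign of the leading coefficient. *)
Lemma pos_at_pinfty (R : rcfType) (P : {poly R}) (x : R) :
  0 < lead_coef P -> exists2 M, x < M & 0 < P.[M].
Proof.
move=> P0; have Pn0 : P != 0 by rewrite -lead_coef_eq0 gt_eqF.
pose M := Num.max x (cauchy_bound P) + 1.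
have MI : M \in `[cauchy_bound P, +oo[.
  by rewrite in_itv /= andbT ler_wpDr // le_max lexx orbT.
have := sgp_pinftyP (ge_cauchy_bound Pn0) MI.
rewrite /sgp_pinfty (gtr0_sg P0) => /eqP; rewrite sgr_cp0 => PM.
by exists M; rewrite // ltr_pwDr // le_max lexx.
Qed.

Lemma pos_at_minfty (R : rcfType) (P : {poly R}) (x : R) :
  0 < (-1) ^+ (size P).-1 * lead_coef P -> exists2 M, M < x & 0 < P.[M].
Proof.
move=> P0; have Pn0 : P != 0.
  by rewrite -lead_coef_eq0; apply: contraTneq P0 => ->; rewrite mulr0 ltxx.
pose M := Num.min x (- cauchy_bound P) - 1.
have MI : M \in `]-oo, - cauchy_bound P].
  by rewrite in_itv /= lerBlDr ler_wpDr // ge_min lexx orbT.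
have := sgp_minftyP (le_cauchy_bound Pn0) MI.
rewrite /sgp_minfty (gtr0_sg P0) => /eqP; rewrite sgr_cp0 => PM.
by exists M; rewrite // ltrBlDr ltr_pwDr // ge_min lexx.
Qed.

(** * Signs of G along the roots of F, and the roots of G they enforce *)

Section Tangency.

Variables (R : rcfType) (d : nat) (p lam : nat -> R) (A B G : {poly R}).
Hypothesis p_lt : forall i, (i < d)%N -> p i < p i.+1.
Hypothesis lamI : forall n, (n < d)%N -> p n <= lam n <= p n.+1.
Hypothesis Asign : forall m, (m <= d)%N -> 0 <= (-1) ^+ (d + m) * A.[p m].
Hypothesis B0 :
  forall m, (m <= d)%N -> root (linprod d lam) (p m) -> root B (p m).
Hypothesis GE : G * linprod d.+1 p = B ^+ 2 - A * linprod d lam.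

Lemma points_lt i j : (i < j <= d)%N -> p i < p j.
Proof.
elim: j => // j IHj ij; have [->|ij'] := eqVneq i j; first by apply: p_lt; lia.
by apply: lt_trans (IHj _) (p_lt _); lia.
Qed.

Lemma points_le i j : (i <= j <= d)%N -> p i <= p j.
Proof.
case/andP; rewrite leq_eqVlt => /orP[/eqP -> //|ij jd].
by rewrite ltW // points_lt // ij.
Qed.

Lemma roots_le i j : (i <= j < d)%N -> lam i <= lam j.
Proof.
elim: j => [|j IHj] ij; first by have -> : i = 0%N by nlia.
have [->|ij'] := eqVneq i j.+1; first by [].
have /IHj h0 : (i <= j < d)%N by nlia.
apply: le_trans h0 _.
have [lt_jd lt_j1d] : (j < d)%N /\ (j.+1 < d)%N by nlia.
have [_ h1] := andP (lamI lt_jd); have [h2 _] := andP (lamI lt_j1d).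
exact: le_trans h1 h2.
Qed.

Lemma sign_linprod_bump m : (m <= d)%N ->
  0 < (-1) ^+ (d + m) * (linprod d (fun i => p (bump m i))).[p m].
Proof.
move=> le_md; rewrite lt_neqAle eq_sym mulf_neq0 ?signr_eq0 //=; last first.
  rewrite horner_linprod; apply/prodf_neq0 => i _; rewrite subr_eq0.
  have := ltn_ord i; case: (ltnP i m) => im lt_id.
    by rewrite gt_eqF //; apply: points_lt; rewrite /bump; nlia.
  by rewrite lt_eqF //; apply: points_lt; rewrite /bump; nlia.
by apply: sign_linprod => // i im; apply: points_le; rewrite /bump; nlia.
Qed.

(** If lam n is none of the points, then G H = B^2 there, and n + 1 of the d + 1 points lie to its
    left, which gives the sign of H. If lam n = p m, then B, H and F all vanish there; cancelling
    one factor X - lam n leaves G H1 = - A F1 at lam n, and the signs of A, H1 and F1 are known. *)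
Lemma tangency_sign n : (n < d)%N -> 0 <= (-1) ^+ (d + n) * G.[lam n].
Proof.
move=> lt_nd; have [pn np] := andP (lamI lt_nd).
have Flam : root (linprod d lam) (lam n) by apply/root_linprod; exists n.
have [/root_linprod[m le_md lamE]|Hn0] := boolP (root (linprod d.+1 p) (lam n)).
  have /factor_theorem[B1 BE] : root B (lam n) by rewrite lamE B0 // -lamE.
  have := GE; rewrite (linprod_bump _ le_md) (@linprod_bump _ d lam n lt_nd).
  rewrite -lamE BE.
  have := sign_linprod_bump le_md; rewrite -lamE.
  set H1 := linprod _ _; set F1 := linprod _ _ => H1sign GE'.
  have {}GE' : G * H1 = B1 ^+ 2 * ('X - (lam n)%:P) - A * F1.
    by apply: (mulfI (negbT (polyXsubC_eq0 (lam n)))); rewrite mulrCA GE'; ring.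
  have F1sign : 0 <= (-1) ^+ (d.-1 + n) * F1.[lam n].
    apply: sign_linprod => [|i im|i im]; first by nlia.
      by apply: roots_le; rewrite /bump; nlia.
    by apply: roots_le; rewrite /bump; nlia.
  rewrite -(pmulr_lge0 _ H1sign) mulrACA -hornerM GE' !hornerE subrr mulr0 add0r.
  have dE : (-1) ^+ (d + n) = - (-1) ^+ (d.-1 + n) :> R.
    by rewrite -[d in LHS](ltn_predK lt_nd) addSn exprS mulN1r.
  have Asgn := Asign le_md; rewrite -lamE in Asgn.
  rewrite dE; have -> (s t y z : R) : - s * t * - (y * z) = t * y * (s * z) by ring.
  exact: mulr_ge0.
rewrite -(pmulr_lge0 _ (_ : 0 < (-1) ^+ (d + n) * (linprod d.+1 p).[lam n])).
  rewrite mulrACA -expr2 sqrr_sign mul1r -hornerM GE.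
  rewrite hornerD horner_exp hornerN hornerM.
  by rewrite (eqP Flam) mulr0 subr0 sqr_ge0.
rewrite lt_neqAle eq_sym mulf_neq0 ?signr_eq0 //=.
have -> : (-1) ^+ (d + n) = (-1) ^+ (d.+1 + n.+1) :> R.
  by rewrite addSn addnS !exprS mulrA mulN1r opprK mul1r.
apply: sign_linprod => [|i im|i im]; first by nlia.
  by apply: le_trans pn; apply: points_le; nlia.
by apply: le_trans np _; apply: points_le; nlia.
Qed.

(** A double root of F is squeezed onto the point p (n+1). There F and B^2 are divisible by (X - lam
    n)^2 but H only by X - lam n, so G = (X - lam n) G1 with G1 H1 = B1^2 - A F1, and G'(lam n) =
    G1(lam n). Both B1^2 and - A F1 are non-negative at lam n. *)
Lemma tangency_double_sign n : (n.+1 < d)%N -> lam n = lam n.+1 ->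
  (-1) ^+ (d + n) * G^`().[lam n] <= 0.
Proof.
move=> lt_nd lamE; have lt_nd' := ltnW lt_nd.
have pE : lam n = p n.+1.
  apply/eqP; rewrite eq_le; have [_ ->] := andP (lamI lt_nd').
  by have [] := andP (lamI lt_nd); rewrite -lamE.
have Flam : root (linprod d lam) (lam n) by apply/root_linprod; exists n.
have /factor_theorem[B1 BE] : root B (lam n) by rewrite pE B0 // -pE.
have := GE; rewrite (@linprod_bump _ d.+1 _ n.+1) 1?ltnS //.
rewrite (@linprod_bump _ d lam n lt_nd') (@linprod_bump _ d.-1 _ n); last by nlia.
have -> : lam (bump n n) = lam n by rewrite /bump leqnn add1n.
have := @sign_linprod_bump n.+1 (ltnW lt_nd); rewrite -pE BE /=.
set H1 := linprod _ _; set F1 := linprod _ _ => H1sign GE'.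
have {}GE' : G * H1 = (B1 ^+ 2 - A * F1) * ('X - (lam n)%:P).
  by apply: (mulfI (negbT (polyXsubC_eq0 (lam n)))); rewrite mulrCA GE'; ring.
have H1n0 : H1.[lam n] != 0.
  by apply: contraTneq H1sign => ->; rewrite mulr0 ltxx.
have /factor_theorem[G1 G1E] : root G (lam n).
  have : root (G * H1) (lam n) by rewrite GE' rootM root_XsubC eqxx orbT.
  by rewrite rootM [root H1 _](negbTE H1n0) orbF.
rewrite G1E deriv_mul_XsubC subrr mulr0 add0r.
have {}GE' : G1 * H1 = B1 ^+ 2 - A * F1.
  apply: (mulfI (negbT (polyXsubC_eq0 (lam n)))).
  by rewrite [RHS]mulrC -GE' G1E; ring.
have F1sign : 0 <= (-1) ^+ (d.-2 + n) * F1.[lam n].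
  apply: sign_linprod => [|i im|i im]; first by nlia.
    by apply: roots_le; rewrite /bump; nlia.
  by apply: roots_le; rewrite /bump; nlia.
have Asgn := Asign (ltnW lt_nd); rewrite -pE addnS exprS mulN1r mulNr in Asgn.
rewrite addnS exprS mulN1r mulNr in H1sign.
have dE : (-1) ^+ (d.-2 + n) = (-1) ^+ (d + n) :> R.
  have -> : (d + n = (d.-2 + n).+2)%N by nlia.
  by rewrite !exprS mulrA mulN1r opprK mul1r.
rewrite dE in F1sign.
rewrite -oppr_ge0 -(pmulr_lge0 _ H1sign).
have -> : - ((-1) ^+ (d + n) * G1.[lam n]) * - ((-1) ^+ (d + n) * H1.[lam n])
          = B1.[lam n] ^+ 2 - A.[lam n] * F1.[lam n].
  rewrite mulrNN mulrACA -expr2 sqrr_sign mul1r -hornerM GE'.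
  by rewrite hornerD horner_exp hornerN hornerM.
rewrite addr_ge0 ?sqr_ge0 //.
have -> : - (A.[lam n] * F1.[lam n])
    = - ((-1) ^+ (d + n) * A.[lam n]) * ((-1) ^+ (d + n) * F1.[lam n]).
  by rewrite mulNr mulrACA -expr2 sqrr_sign mul1r.
exact: mulr_ge0.
Qed.

(** The d values lam n give d - 1 roots. If G has degree d, its leading sign gives a further
    alternation point M, below lam 0 for a negative coefficient and above all lam n for a positive
    one. The boolean in the index conditions is the shift caused by a root below lam 0. *)
Lemma tangency_roots : (0 < d)%N -> G != 0 -> (size G <= d.+1)%N ->
  exists s, [/\ sorted <=%R s, size s = (d.-1 + (G`_d != 0)%R)%N,
    G = lead_coef G *: \prod_(y <- s) ('X - y%:P) &
    forall i j, (i < d)%N -> (j < size s)%N ->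
      ((i + (G`_d < 0)%R <= j)%N -> lam i <= s`_j) /\
      ((j < i + (G`_d < 0)%R)%N -> s`_j <= lam i)].
Proof.
move=> d0 Gn0 sG.
have lam_le i : (i.+1 < d)%N -> lam i <= lam i.+1.
  by move=> lt_id; apply: roots_le; nlia.
have lam_lt i : (i.+2 < d)%N -> lam i < lam i.+2.
  move=> lt_id; have [_ h1] := andP (lamI (ltnW (ltnW lt_id))).
  have [h2 _] := andP (lamI lt_id).
  by apply: le_lt_trans h1 (lt_le_trans _ h2); apply: points_lt; nlia.
have leadG : G`_d != 0 -> size G = d.+1 /\ lead_coef G = G`_d.
  move=> Gd; have sE : size G = d.+1.
    by apply/eqP; rewrite eqn_leq sG ltnNge; apply: contra Gd => /leq_sizeP ->.
  by rewrite lead_coefE sE.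
case: (ltgtP G`_d 0) => Gd /=; rewrite ?addn1 ?addn0.
- have [sE lE] := leadG (negbT (lt_eqF Gd)).
  have [|M Mlt GM] := @pos_at_minfty _ ((-1) ^+ d.+1 *: G) (lam 0%N).
    rewrite size_scale ?signr_eq0 // lead_coefZ sE lE /= mulrA -exprD addnS.
    by rewrite exprS exprD -expr2 sqrr_sign mulr1 mulN1r oppr_gt0.
  pose z i := if i is j.+1 then lam j else M.
  have [||||| s [ss sz sE' sI]] := @weak_alternation_seq _ d d.+1 G z.
  + by case=> [|i] lt_id /=; [apply: ltW | apply: lam_le].
  + case=> [|i] lt_id /=; last exact: lam_lt.
    by apply: lt_le_trans Mlt _; apply: roots_le; nlia.
  + case=> [|i] lt_id /=; first by rewrite addn0 -hornerZ ltW.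
    by rewrite addSn addnS !exprS mulrA mulN1r opprK mul1r tangency_sign.
  + case=> [|i] lt_id /= zE; first by have := Mlt; rewrite zE ltxx.
    rewrite addSn addnS !exprS mulrA mulN1r opprK mul1r.
    exact: tangency_double_sign.
  + by [].
  exists s; split=> //; first by rewrite sz prednK.
  by move=> i j lt_id; rewrite sz addn1 => lt_js; exact: (sI i.+1 j).
- have [sE lE] := leadG (negbT (gt_eqF Gd)).
  have [|M Mlt GM] := @pos_at_pinfty _ G (lam d.-1); first by rewrite lE.
  pose z i := if (i < d)%N then lam i else M.
  have [||||| s [ss sz sE' sI]] := @weak_alternation_seq _ d d G z.
  + move=> i lt_id; rewrite /z lt_id; case: ifP => [|/negbT] lt_i1d.
      exact: lam_le.
    by have -> : i = d.-1 by [nlia]; exact: ltW.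
  + move=> i lt_id; rewrite /z (ltnW lt_id); case: ifP => [|/negbT] lt_i1d.
      exact: lam_lt.
    by apply: le_lt_trans Mlt; apply: roots_le; nlia.
  + move=> i le_id; rewrite /z; case: ifP => [|/negbT] lt_id.
      exact: tangency_sign.
    have -> : i = d by nlia.
    by rewrite exprD -expr2 sqrr_sign mul1r ltW.
  + move=> i lt_id; rewrite /z lt_id; case: ifP => [|/negbT] lt_i1d.
      exact: tangency_double_sign.
    by have {1 2}-> : i = d.-1 by [nlia]; move=> zE; have := Mlt; rewrite zE ltxx.
  + by [].
  exists s; split=> //; first by rewrite sz prednK.
  move=> i j lt_id lt_js; rewrite sz in lt_js; have := sI i j (ltnW lt_id) lt_js.
  by rewrite /z lt_id addn0.
(* The coefficient of X^d is 0, so the d - 1 sign changes along lam already exhaust the degree. *)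
have [||||| s [ss sz sE' sI]] := @weak_alternation_seq _ d.-1 d G lam.
+ by move=> i lt_id; apply: lam_le; nlia.
+ by move=> i lt_id; apply: lam_lt; nlia.
+ by move=> i lt_id; apply: tangency_sign; nlia.
+ by move=> i lt_id; apply: tangency_double_sign; nlia.
+ rewrite prednK //; apply/leq_sizeP => j; rewrite leq_eqVlt => /orP[/eqP <- //|].
  by move=> dj; apply/leq_sizeP: dj.
exists s; split=> //.
by move=> i j lt_id; rewrite sz addn0 => lt_js; apply: sI; nlia.
Qed.

End Tangency.

(** * Merging interlaced sequences *)

(** Not a general merge: only elements of equal index are compared, so that the i-th pair occupies
    the positions 2i and 2i + 1. This is the pair structure {b_(2i-1), b_2i} of the theorem. [leT]
    will be <= for the b and >= for the c, both lists running away from 0. *)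
Fixpoint interleave (T : Type) (leT : rel T) (s e : seq T) : seq T :=
  match s, e with
  | a :: s', x :: e' =>
      if leT a x then [:: a, x & interleave leT s' e']
      else [:: x, a & interleave leT s' e']
  | [::], _ => e
  | _, [::] => s
  end.

Lemma perm_interleave (T : eqType) (leT : rel T) (s e : seq T) :
  perm_eq (interleave leT s e) (s ++ e).
Proof.
elim: s e => [|a s IHs] [|x e] //=; first by rewrite cats0.
have E : perm_eq [:: a, x & interleave leT s e] (a :: s ++ x :: e).
  by rewrite perm_cons perm_sym -[x :: e]cat1s perm_catCA /= perm_cons perm_sym.
case: ifP => // _; apply: perm_trans E.
by rewrite -[X in perm_eq X _]cat1s -[X in perm_eq _ X]cat1s
  (perm_catCA [:: x] [:: a]).
Qed.

Lemma size_interleave (T : eqType) (leT : rel T) (s e : seq T) :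
  size (interleave leT s e) = (size s + size e)%N.
Proof. by rewrite (perm_size (perm_interleave leT s e)) size_cat. Qed.

Lemma nth_interleave (T : Type) (leT : rel T) (x0 : T) (s e : seq T) i :
    (i < size s)%N -> (i < size e)%N ->
  let a := nth x0 s i in let x := nth x0 e i in
  nth x0 (interleave leT s e) (2 * i) = (if leT a x then a else x) /\
  nth x0 (interleave leT s e) (2 * i).+1 = (if leT a x then x else a).
Proof.
elim: i s e => [|i IHi] [|a s] [|x e] //= si ei; first by case: ifP.
by rewrite mulnS; case: ifP => _; exact: IHi.
Qed.

Lemma nth_interleave_last (T : Type) (leT : rel T) (x0 : T) (s e : seq T) :
  (size s < size e)%N ->
  nth x0 (interleave leT s e) (2 * size s) = nth x0 e (size s).
Proof.
elim: s e => [|a s IHs] [|x e] //=; rewrite ltnS => /IHs IH.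
by rewrite mulnS; case: ifP.
Qed.

(* L 0 <= s 0 <= L 1 <= s 1 <= ... *)
Definition interlaced (T : Type) (leT : rel T) (L : nat -> T) (n : nat)
    (s : seq T) (x0 : T) : Prop :=
  forall i j, (i < n)%N -> (j < size s)%N ->
    ((i <= j)%N -> leT (L i) (nth x0 s j)) /\
    ((j < i)%N -> leT (nth x0 s j) (L i)).

Section Interleave.

Variables (T : eqType) (leT : rel T) (x0 : T).
Hypotheses (leT_total : total leT) (leT_trans : transitive leT).
Variables (s e : seq T).
Hypothesis size_se : (size s <= size e <= (size s).+1)%N.

Let b := interleave leT s e.

Lemma mem_interleave i : (i < size s)%N ->
  nth x0 s i \in [:: nth x0 b (2 * i); nth x0 b (2 * i).+1].
Proof.
move=> si; have [|-> ->] := @nth_interleave _ leT x0 s e i si; first by nlia.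
by case: ifP => _; rewrite !inE eqxx ?orbT.
Qed.

Lemma interleave_even_le i : (i < size e)%N ->
  leT (nth x0 b (2 * i)) (nth x0 e i).
Proof.
have leTxx x : leT x x by have := leT_total x x; rewrite orbb.
case: (ltnP i (size s)) => [si ei|si ei].
  by have [-> _] := @nth_interleave _ leT x0 s e i si ei; case: ifP.
have -> : i = size s by nlia.
by rewrite /b nth_interleave_last //; nlia.
Qed.

Lemma interleave_odd_ge i : (i < size s)%N ->
  leT (nth x0 e i) (nth x0 b (2 * i).+1).
Proof.
have leTxx x : leT x x by have := leT_total x x; rewrite orbb.
move=> si; have [|_ ->] := @nth_interleave _ leT x0 s e i si; first by nlia.
by have := leT_total (nth x0 s i) (nth x0 e i); case: ifP.
Qed.

Variables (L : nat -> T).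
Hypothesis Ls : interlaced leT L (size e) s x0.
Hypothesis Le : interlaced leT L (size e) e x0.

Lemma interleave_even_ge i : (i < size e)%N -> leT (L i) (nth x0 b (2 * i)).
Proof.
move=> ei; case: (ltnP i (size s)) => si; last first.
  have iE : i = size s by nlia.
  rewrite /b {2}iE nth_interleave_last -?iE //.
  by have [-> //] := Le ei ei.
have [-> _] := @nth_interleave _ leT x0 s e i si ei.
by case: ifP => _; [case: (Ls ei si) | case: (Le ei ei)] => ->.
Qed.

Lemma interleave_odd_le i : (i.+1 < size e)%N ->
  leT (nth x0 b (2 * i).+1) (L i.+1).
Proof.
move=> ei; have [si ei'] : (i < size s)%N /\ (i < size e)%N by nlia.
have [_ ->] := @nth_interleave _ leT x0 s e i si ei'.
by case: ifP => _; [case: (Le ei ei') | case: (Ls ei si)] => _ ->.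
Qed.

(** Within a pair the order holds by construction; consecutive pairs are separated by a value of
    [L]. *)
Lemma sorted_interleave : sorted leT b.
Proof.
apply/(sortedP x0) => i; rewrite size_interleave => ib.
have [j [iE|iE]] : exists j, i = (2 * j)%N \/ i = (2 * j).+1.
  by exists i./2; have := odd_double_half i; case: (odd i); nlia.
  have [sj ej] : (j < size s)%N /\ (j < size e)%N by nlia.
  rewrite iE; have [-> ->] := @nth_interleave _ leT x0 s e j sj ej.
  by have := leT_total (nth x0 s j) (nth x0 e j); case: ifP.
have ej : (j.+1 < size e)%N by nlia.
rewrite iE; apply: leT_trans (interleave_odd_le ej) _.
by have -> : ((2 * j).+2 = 2 * j.+1)%N by [nlia]; apply: interleave_even_ge.
Qed.

Lemma all_interleave_ge : all (leT (L 0%N)) b.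
Proof.
rewrite (perm_all _ (perm_interleave leT s e)) all_cat.
apply/andP; split; apply/(all_nthP x0) => j js.
  by case: (@Ls 0%N j _ js) => [|-> //]; nlia.
by case: (@Le 0%N j _ js) => [|-> //]; nlia.
Qed.

End Interleave.

(** * The confocal family *)

Definition pole (R : realType) (k l : nat) (a : 'I_(k + l) -> R)
    (i : 'I_(k + l)) : R := eps R i * a i.

Definition poles (R : realType) (k l : nat) (a : 'I_(k + l) -> R) : seq R :=
  [seq pole a i | i <- enum 'I_(k + l)].

(** The poles are numbered in decreasing order; reversing both blocks yields the increasing sequence
    p_0 < ... < p_d, with 0 at index [l]. *)
Definition points (R : realType) (k l : nat) (a : 'I_(k + l) -> R) : seq R :=
  rev (drop k (poles a)) ++ 0 :: rev (take k (poles a)).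

Lemma poly_fun_eq0 (R : numDomainType) (P : {poly R}) :
  (forall x, P.[x] = 0) -> P = 0.
Proof.
move=> P0; apply: (@roots_geq_poly_eq0 _ _ [seq i%:R | i <- iota 0 (size P)]).
- by apply/allP => y _; rewrite rootE P0.
- by rewrite map_inj_uniq ?iota_uniq // => i j /eqP; rewrite eqr_nat => /eqP.
- by rewrite size_map size_iota.
Qed.

Section Confocal.

Variables (R : realType) (k l : nat) (a : 'I_(k + l) -> R).
Hypothesis ha : confocal_constants a.

Lemma eps_sqr (i : 'I_(k + l)) : eps R i * eps R i = 1.
Proof. by rewrite /eps; case: ifP => _; rewrite ?mulrNN mulr1. Qed.

Lemma pole_lt (i j : 'I_(k + l)) : (i < j)%N -> pole a j < pole a i.
Proof. by case: ha => _; apply. Qed.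

Lemma size_poles : size (poles a) = (k + l)%N.
Proof. by rewrite size_map size_enum_ord. Qed.

Lemma nth_poles (i : 'I_(k + l)) : (poles a)`_i = pole a i.
Proof. by rewrite (nth_map i) ?size_enum_ord // nth_ord_enum. Qed.

Lemma poles_lt i j : (i < j < k + l)%N -> (poles a)`_j < (poles a)`_i.
Proof.
case/andP=> ij jd; have := @pole_lt (Ordinal (ltn_trans ij jd)) (Ordinal jd) ij.
by rewrite -!nth_poles.
Qed.

Lemma poles_gt0 i : (i < k)%N -> 0 < (poles a)`_i.
Proof.
move=> ik; have id : (i < k + l)%N by nlia.
rewrite -[i]/(nat_of_ord (Ordinal id)) nth_poles /pole /eps /= ik mul1r.
by case: ha.
Qed.

Lemma poles_lt0 i : (k <= i < k + l)%N -> (poles a)`_i < 0.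
Proof.
case/andP=> ki id; rewrite -[i]/(nat_of_ord (Ordinal id)) nth_poles.
by rewrite /pole /eps /= ltnNge ki mulN1r oppr_lt0; case: ha.
Qed.

Lemma nth_points_neg i : (i < l)%N ->
  (points a)`_(l.-1 - i) = (poles a)`_(k + i).
Proof.
move=> il; rewrite nth_cat size_rev size_drop size_poles addKn.
have -> : (l.-1 - i < l)%N by nlia.
rewrite nth_rev ?size_drop ?size_poles ?addKn; last by nlia.
by rewrite nth_drop; congr nth; nlia.
Qed.

Lemma nth_points_mid : (points a)`_l = 0.
Proof. by rewrite nth_cat size_rev size_drop size_poles addKn ltnn subnn. Qed.

Lemma nth_points_pos i : (i < k)%N ->
  (points a)`_(l.+1 + i) = (poles a)`_(k.-1 - i).
Proof.
move=> ik; rewrite nth_cat size_rev size_drop size_poles addKn.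
have -> : (l.+1 + i < l)%N = false by nlia.
have -> : (l.+1 + i - l = i.+1)%N by nlia.
have sz : size (take k (poles a)) = k by rewrite size_takel // size_poles leq_addr.
rewrite /= nth_rev sz //; rewrite nth_take; last by nlia.
by congr nth; nlia.
Qed.

Lemma points_cases m : (m <= k + l)%N ->
  [\/ exists2 i, (i < l)%N & m = (l.-1 - i)%N, m = l |
      exists2 i, (i < k)%N & m = (l.+1 + i)%N].
Proof.
move=> md; case: (ltngtP m l) => ml.
- by constructor 1; exists (l.-1 - m)%N; nlia.
- by constructor 3; exists (m - l.+1)%N; nlia.
- by constructor 2.
Qed.

Lemma points_increasing i : (i < k + l)%N -> (points a)`_i < (points a)`_i.+1.
Proof.
move=> id; case: (points_cases (ltnW id)) => [[j jl ->]|iE|[j jk iE]].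
- rewrite nth_points_neg //; case: j jl => [|j] jl.
    have -> : ((l.-1 - 0).+1 = l)%N by nlia.
    by rewrite nth_points_mid poles_lt0 //; nlia.
  have -> : ((l.-1 - j.+1).+1 = l.-1 - j)%N by nlia.
  by rewrite nth_points_neg ?poles_lt //; nlia.
- rewrite iE nth_points_mid -[l.+1]addn0 nth_points_pos ?poles_gt0 //; nlia.
rewrite iE nth_points_pos // -addnS nth_points_pos ?poles_lt //; nlia.
Qed.

Lemma point_sign m : (m <= k + l)%N ->
  m = l \/ exists i : 'I_(k + l),
    (points a)`_m = pole a i /\ (-1) ^+ (k + l + m) = eps R i * (-1) ^+ i.
Proof.
move=> md; case: (points_cases md) => [[j jl ->]|->|[j jk ->]]; first 2 last.
- right; have id : (k.-1 - j < k + l)%N by nlia.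
  exists (Ordinal id); rewrite -nth_poles nth_points_pos //=; split=> //.
  rewrite /eps /= (_ : (k.-1 - j < k)%N) ?mul1r; last by nlia.
  have -> : (k + l + (l.+1 + j) = (k.-1 - j) + 2 * (l + j.+1))%N by nlia.
  by rewrite exprD exprM sqrrN !expr1n mulr1.
- right; have id : (k + j < k + l)%N by nlia.
  exists (Ordinal id); rewrite -nth_poles nth_points_neg //=; split=> //.
  rewrite /eps /= (_ : (k + j < k)%N = false); last by nlia.
  have -> : (k + l + (l.-1 - j) = (k + j).+1 + 2 * (l.-1 - j))%N by nlia.
  by rewrite exprD exprM sqrrN !expr1n mulr1 exprS.
by left.
Qed.

Lemma linprod_points :
  linprod (k + l).+1 (nth 0 (points a)) = 'X * \prod_i ('X - (pole a i)%:P).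
Proof.
have sz : size (points a) = (k + l).+1.
  rewrite size_cat /= !size_rev size_drop size_take_min size_poles; nlia.
rewrite linprodE -sz mkseq_nth /points.
have /(perm_big _) -> /= : perm_eq (points a) (0 :: poles a).
  rewrite /points perm_catC /= perm_cons -{3}[poles a](cat_take_drop k).
  by apply: perm_cat; rewrite perm_rev.
by rewrite big_cons subr0 big_map big_enum.
Qed.

End Confocal.

(** The product of A_lam u with w, with the common denominator cleared. *)
Definition cofactor_sum (R : realType) (k l : nat) (a : 'I_(k + l) -> R)
    (u w : 'cV[R]_(k + l)) : {poly R} :=
  \sum_i (u i 0 * w i 0) *: \prod_(j | j != i) denom a j.

(** The leading coefficient of the product of all denominators, equal to (-1)^k; multiplying by its
    negative makes [containing_poly] monic. *)
Definition denom_sign (R : realType) (k l : nat) : R :=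
  \prod_(i < k + l) - eps R i.

(** * The polynomials F, A, B and G of a line, their signs at the poles and their degrees *)

Section Polynomials.

Variables (R : realType) (k l : nat) (a : 'I_(k + l) -> R).
Hypothesis ha : confocal_constants a.

Local Notation kappa := (denom_sign R k l).
Local Notation p := (nth 0 (points a)).

Lemma denom_pole i : denom a i = - eps R i *: ('X - (pole a i)%:P).
Proof.
rewrite scalerBr !scaleNr opprK addrC /denom; congr (_ - _).
by rewrite -mul_polyC -polyCM /pole mulrA eps_sqr mul1r.
Qed.

Lemma prod_denom (Q : pred 'I_(k + l)) :
  \prod_(i | Q i) denom a i
  = (\prod_(i : 'I_(k + l) | Q i) - eps R i)
    *: \prod_(i | Q i) ('X - (pole a i)%:P).
Proof. by under eq_bigr do rewrite denom_pole; rewrite scaler_prod. Qed.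

Lemma denom_sign_sqr : kappa * kappa = 1.
Proof.
rewrite /denom_sign -big_split big1 //= => i _.
by rewrite mulrNN eps_sqr.
Qed.

Lemma denom_sign_neq0 : kappa != 0.
Proof.
by apply/eqP => k0; have := denom_sign_sqr; rewrite k0 mul0r => /esym/eqP;
  rewrite oner_eq0.
Qed.

Lemma denom_signE i : kappa * \prod_(j : 'I_(k + l) | j != i) - eps R j = - eps R i.
Proof.
have h : (\prod_(j : 'I_(k + l) | j != i) - eps R j)
         * (\prod_(j : 'I_(k + l) | j != i) - eps R j) = 1 :> R.
  by rewrite -big_split big1 //= => j _; rewrite mulrNN eps_sqr.
by rewrite /denom_sign (bigD1 i) //= -mulrA h mulr1.
Qed.

(** Exactly the i factors with j < i are negative, the poles being decreasing. *)
Lemma sign_pole_diffs (i : 'I_(k + l)) :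
  0 < (-1) ^+ i * \prod_(j | j != i) (pole a i - pole a j).
Proof.
rewrite (bigID (fun j : 'I_(k + l) => (j < i)%N)) /= mulrA mulr_gt0 //; last first.
  apply: prodr_gt0 => j /andP[ji]; rewrite -leqNgt => ij.
  by rewrite subr_gt0 pole_lt // ltn_neqAle eq_sym ij andbT.
rewrite (eq_bigl (fun j : 'I_(k + l) => (j < i)%N)); last first.
  by move=> j; rewrite andbC; case: ltnP => //= ji; rewrite neq_ltn ji.
have -> : (-1) ^+ i = \prod_(j < k + l | (j < i)%N) -1 :> R.
  rewrite -(big_ord_widen _ (fun=> -1)) ?prodr_const ?card_ord //.
  exact: ltnW.
rewrite -big_split /=; apply: prodr_gt0 => j ji.
by rewrite mulN1r opprB subr_gt0 pole_lt.
Qed.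

Lemma horner_prod_denom lam :
  (\prod_i denom a i).[lam] = \prod_i (a i - eps R i * lam).
Proof. by rewrite horner_prod; apply: eq_bigr => i _; rewrite denomE. Qed.

Lemma containing_cofactor y :
  containing_poly a y = cofactor_sum a y y - \prod_i denom a i.
Proof.
by congr (_ - _); apply: eq_bigr => i _; rewrite expr2.
Qed.

Lemma tangency_poly_shift x v t :
  tangency_poly a (x + t *: v) v = tangency_poly a x v.
Proof.
rewrite /tangency_poly; congr (_ - _); apply: eq_bigr => i _.
apply: eq_bigr => j _; rewrite !mxE; congr (_ ^+ 2 *: _); ring.
Qed.

Lemma horner_cofactor_sum u w lam : (forall i, a i - eps R i * lam != 0) ->
  (cofactor_sum a u w).[lam]
  = dot (conf_mx a lam *m u) w * (\prod_i denom a i).[lam].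
Proof.
move=> a0; rewrite /cofactor_sum horner_sum conf_dotE mulr_suml.
apply: eq_bigr => i _; rewrite hornerZ [in RHS](bigD1 i) //= hornerM denomE.
by rewrite mulrA divfK.
Qed.

(** Where D does not vanish, this is the definition of [tangency_disc] with denominators cleared.
    Multiplying the difference by D once more also covers the zeros of D, and a polynomial vanishing
    everywhere is 0. *)
Lemma tangency_identity y v :
  tangency_poly a y v * \prod_i denom a i
  = cofactor_sum a y v ^+ 2 - cofactor_sum a v v * containing_poly a y.
Proof.
set D := \prod_i denom a i.
have D0 : D != 0.
  rewrite /D prod_denom scaler_eq0 negb_or denom_sign_neq0.
  by rewrite monic_neq0 // monic_prod_XsubC.
apply/eqP; rewrite -subr_eq0; apply/eqP; apply: (mulIf D0); rewrite mul0r.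
apply: poly_fun_eq0 => lam; rewrite hornerM.
have [->|Dl] := eqVneq D.[lam] 0; first by rewrite mulr0.
have a0 i : a i - eps R i * lam != 0.
  by move: Dl; rewrite horner_prod_denom => /prodf_neq0 /(_ i isT).
apply/eqP; rewrite mulf_eq0 (negbTE Dl) orbF.
rewrite containing_cofactor -/D.
have tpE := tangency_polyE y v a0; rewrite -horner_prod_denom -/D in tpE.
move: (tangency_poly a y v) tpE => T tpE.
have {}tpE : T.[lam] = tangency_disc a y v lam * D.[lam] by rewrite tpE divfK.
rewrite !(hornerD, hornerN, horner_exp, hornerM) !horner_cofactor_sum //.
by rewrite tpE /tangency_disc; apply/eqP; rewrite -/D; ring.
Qed.

Lemma cofactor_sum_pole u w i :
  (cofactor_sum a u w).[pole a i]
  = u i 0 * w i 0 * (\prod_(j | j != i) denom a j).[pole a i].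
Proof.
rewrite /cofactor_sum horner_sum (bigD1 i) //= [X in _ + X]big1 ?addr0 ?hornerZ //.
move=> j ji.
rewrite hornerZ (bigD1 i) 1?eq_sym //= hornerM denom_pole hornerZ hornerXsubC.
by rewrite subrr mulr0 mul0r mulr0.
Qed.

(** This is the sign of H' at the point. F and A will differ from the quantity bounded here only by
    square factors, so both inherit its sign weakly. *)
Lemma cofactor_pole_sign m (i : 'I_(k + l)) : (m <= k + l)%N -> p m = pole a i ->
    (-1) ^+ (k + l + m) = eps R i * (-1) ^+ i ->
  0 < (-1) ^+ (k + l + m)
      * (- kappa * (\prod_(j | j != i) denom a j).[pole a i]).
Proof.
move=> md pm ->; rewrite prod_denom hornerZ mulNr mulrA denom_signE mulNr opprK.
rewrite mulrACA eps_sqr mul1r horner_prod.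
by under eq_bigr do rewrite hornerXsubC; apply: sign_pole_diffs.
Qed.


Lemma size_prod_XsubC_card (Q : pred 'I_(k + l)) :
  size (\prod_(i | Q i) ('X - (pole a i)%:P)) = #|Q|.+1.
Proof.
by rewrite (eq_bigl (mem Q)) // -big_enum size_prod_XsubC -cardE.
Qed.

Lemma size_prod_denom (Q : pred 'I_(k + l)) :
  size (\prod_(i | Q i) denom a i)%R = #|Q|.+1.
Proof.
rewrite prod_denom size_scale ?size_prod_XsubC_card //.
apply/prodf_neq0 => i _; apply/eqP => e0; have := eps_sqr R i.
by move/eqP: e0; rewrite oppr_eq0 => /eqP ->; rewrite mul0r => /esym/eqP;
  rewrite oner_eq0.
Qed.

Lemma size_sum_leq (I : finType) (Q : pred I) (F : I -> {poly R}) n :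
    (forall i, Q i -> (size (F i) <= n)%N) ->
  (size (\sum_(i | Q i) F i)%R <= n)%N.
Proof.
move=> F_le; elim/big_ind: _ => // [|f g fn gn]; first by rewrite size_poly0.
by rewrite (leq_trans (size_polyD _ _)) // geq_max fn.
Qed.

Lemma card_predC1_ord (i : 'I_(k + l)) :
  #|[pred j : 'I_(k + l) | j != i]|.+1 = (k + l)%N.
Proof.
have := cardC1 i; rewrite card_ord => ->.
by rewrite prednK // (leq_trans _ (ltn_ord i)).
Qed.

Lemma size_cofactor_sum u w : (size (cofactor_sum a u w) <= k + l)%N.
Proof.
apply: size_sum_leq => i _; rewrite (leq_trans (size_scale_leq _ _)) //.
by rewrite size_prod_denom card_predC1_ord.
Qed.

Lemma normalized_containingE y :
  - kappa *: containing_poly a y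
  = \prod_i ('X - (pole a i)%:P) - kappa *: cofactor_sum a y y.
Proof.
rewrite containing_cofactor prod_denom scalerBr scalerA mulNr denom_sign_sqr.
by rewrite !scaleNr scale1r opprK addrC.
Qed.

Lemma monic_normalized_containing y :
  - kappa *: containing_poly a y \is monic.
Proof.
rewrite monicE normalized_containingE lead_coefDl ?lead_coef_prod_XsubC //.
rewrite size_polyN size_scale ?denom_sign_neq0 // size_prod_XsubC_card card_ord.
by rewrite ltnS size_cofactor_sum.
Qed.

Lemma size_normalized_containing y :
  size (- kappa *: containing_poly a y) = (k + l).+1.
Proof.
rewrite normalized_containingE size_polyDl size_prod_XsubC_card card_ord //.
by rewrite size_polyN size_scale ?denom_sign_neq0 // ltnS size_cofactor_sum.
Qed.

Lemma denom_sign_eq : kappa = (-1) ^+ k.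
Proof.
rewrite /denom_sign big_split_ord /= [X in _ * X]big1 ?mulr1 => [|i _].
  by rewrite -[k in RHS]card_ord -prodr_const; apply: eq_bigr => i _;
    rewrite /eps /= ltn_ord.
by rewrite /eps /= ltnNge leq_addr opprK.
Qed.

Lemma containing_at_pole y i :
  (containing_poly a y).[pole a i]
  = y i 0 ^+ 2 * (\prod_(j | j != i) denom a j).[pole a i].
Proof.
rewrite containing_cofactor hornerD hornerN cofactor_sum_pole [X in _ - X](_ : _ = 0).
  by rewrite subr0 expr2.
rewrite [X in X.[_]](bigD1 i) //= hornerM denom_pole hornerZ hornerXsubC.
by rewrite subrr mulr0 mul0r.
Qed.

(** At 0 every denominator is a_i > 0, so the unnormalized polynomial has the sign of the ellipsoid
    form minus 1, which is negative inside. *)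
Lemma containing_at_0 y : inside_ellipsoid a y ->
  0 < (-1) ^+ k * (- kappa *: containing_poly a y).[0].
Proof.
move=> y_in; have a0 i : a i - eps R i * 0 != 0.
  by rewrite mulr0 subr0; case: ha => /(_ i)/gt_eqF ->.
have D0 : 0 < (\prod_i denom a i).[0].
  rewrite horner_prod_denom; apply: prodr_gt0 => i _; rewrite mulr0 subr0.
  by case: ha => /(_ i).
rewrite hornerZ denom_sign_eq mulrA mulrN -expr2 sqrr_sign mulN1r oppr_gt0.
have := containing_polyE y a0; rewrite -horner_prod_denom => E.
by rewrite -(pmulr_llt0 _ (_ : 0 < (\prod_i denom a i).[0]^-1)) ?invr_gt0 // -E
  subr_lt0.
Qed.

Lemma containing_sign y m : inside_ellipsoid a y -> (m <= k + l)%N ->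
  0 <= (-1) ^+ (k + l + m) * (- kappa *: containing_poly a y).[p m].
Proof.
move=> y_in md; have [->|[i [pm sm]]] := point_sign a md.
  rewrite nth_points_mid // -addnA addnn -mul2n exprD exprM sqrrN !expr1n mulr1.
  exact/ltW/containing_at_0.
have := cofactor_pole_sign md pm sm; rewrite pm hornerZ containing_at_pole => h.
have -> (s t y2 u : R) : s * (t * (y2 * u)) = y2 * (s * (t * u)) by ring.
by rewrite mulr_ge0 ?sqr_ge0 // ltW.
Qed.

Lemma containing_roots y : inside_ellipsoid a y ->
  exists2 lam, (forall n, (n < k + l)%N -> p n <= lam n <= p n.+1)
    & - kappa *: containing_poly a y = linprod (k + l) lam.
Proof.
move=> y_in; apply: alternating_roots.
- by move=> i; apply: points_increasing.
- exact: monic_normalized_containing.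
- exact: size_normalized_containing.
- by move=> m; apply: containing_sign.
Qed.

(** The products omitting two denominators have degree below d - 1. Those omitting the i-th one have
    leading coefficient - eps_i up to [kappa], by [denom_signE]. *)
Lemma coef_tangency_poly y v : (0 < k + l)%N ->
  (kappa *: ('X * tangency_poly a y v))`_(k + l) = - pseudo_dot v v.
Proof.
rewrite lt0n => /negbTE d0; rewrite coefZ coefXM d0.
rewrite /tangency_poly coefB !coef_sum [X in _ - X]big1 ?subr0 => [|i _].
  rewrite mulr_sumr -sumrN; apply: eq_bigr => i _; rewrite coefZ.
  have -> : (\prod_(j | j != i) denom a j)`_(k + l).-1
            = \prod_(j : 'I_(k + l) | j != i) - eps R j.
    have cE : #|(fun j => j != i)| = (k + l).-1.
      by have := cardC1 i; rewrite card_ord.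
    have := lead_coef_prod_XsubC (index_enum _) (fun j => j != i) (pole a).
    by rewrite lead_coefE size_prod_XsubC_card cE prod_denom coefZ => ->;
      rewrite mulr1.
  by rewrite mulrCA denom_signE; ring.
rewrite coef_sum big1 // => j ij; rewrite coefZ.
rewrite [X in _ * X]nth_default ?mulr0 //.
have : (#|[pred m | (m != i) && (m != j)]| < #|predC1 i|)%N.
  apply/proper_card/properP; split; first by apply/subsetP => m /andP[].
  by exists j; rewrite !inE ?eqxx ?andbF // neq_ltn ij orbT.
by rewrite cardC1 card_ord size_prod_denom.
Qed.

Lemma touched_roots y v lam : (0 < k + l)%N ->
    inside_ellipsoid a y -> tangency_disc a y v 0 != 0 ->
    (forall n, (n < k + l)%N -> p n <= lam n <= p n.+1) ->
    - kappa *: containing_poly a y = linprod (k + l) lam ->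
  let G := kappa *: ('X * tangency_poly a y v) in
  let o := (0 < pseudo_dot v v) : nat in
  G != 0 /\ exists s, [/\ sorted <=%R s,
    size s = ((k + l).-1 + (pseudo_dot v v != 0)%R)%N,
    G = lead_coef G *: \prod_(y <- s) ('X - y%:P) &
    forall i j, (i < k + l)%N -> (j < size s)%N ->
      ((i + o <= j)%N -> lam i <= s`_j) /\ ((j < i + o)%N -> s`_j <= lam i)].
Proof.
move=> d0 y_in disc0 lamI FE G o; have G0 : G != 0.
  rewrite scaler_eq0 negb_or denom_sign_neq0 mulf_neq0 ?polyX_eq0 //.
  apply: contraNneq disc0 => P0; rewrite tangency_polyE ?P0 ?horner0 ?mul0r //.
  by move=> i; rewrite mulr0 subr0; case: ha => /(_ i)/gt_eqF ->.
split=> //.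
(* The tangency identity is multiplied by X^2: one X enters G and the other completes H by the point
   0, where A and B then vanish. *)
have := @tangency_roots R (k + l) p lam
  (- kappa *: ('X ^+ 2 * cofactor_sum a v v)) ('X * cofactor_sum a y v) G.
rewrite coef_tangency_poly // oppr_lt0 oppr_eq0; apply=> //.
- by move=> i; apply: points_increasing.
- move=> m md; have [->|[i [pm sm]]] := point_sign a md.
    by rewrite nth_points_mid // hornerZ hornerM horner_exp hornerX expr0n mul0r
      !mulr0.
  have := cofactor_pole_sign md pm sm.
  rewrite pm hornerZ hornerM horner_exp hornerX cofactor_sum_pole -expr2 => h.
  have -> (s t x2 y2 u : R) : s * (t * (x2 * (y2 * u))) = x2 * y2 * (s * (t * u)).
    by ring.
  by apply: mulr_ge0; [rewrite mulr_ge0 ?sqr_ge0 | exact: ltW].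
(* If F vanishes at the i-th pole, then y_i = 0, and this kills the only surviving term of B. *)
- move=> m md; have [->|[i [pm sm]]] := point_sign a md.
    by rewrite nth_points_mid // => _; rewrite rootE hornerM hornerX mul0r.
  have := cofactor_pole_sign md pm sm; rewrite -FE pm.
  rewrite !rootE hornerZ containing_at_pole hornerM cofactor_sum_pole => h.
  rewrite mulrCA mulf_eq0 => /orP[|/eqP e0]; last by move: h; rewrite e0 mulr0 ltxx.
  by rewrite sqrf_eq0 => /eqP ->; rewrite !mul0r mulr0.
- have := tangency_identity y v; rewrite prod_denom -/kappa => E.
  rewrite -FE linprod_points // /G -scalerAl -scalerAl -scalerAr scalerA.
  rewrite mulrNN denom_sign_sqr scale1r.
  have -> (A B C : {poly R}) : ('X * B) ^+ 2 - 'X^2 * A * C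
      = 'X^2 * (B ^+ 2 - A * C).
    by ring.
  by rewrite -E -!scalerAr; congr (_ *: _); ring.
- rewrite size_scale ?denom_sign_neq0 // mulrC size_mulX ?ltnS ?size_tangency_poly //.
  by move: G0; rewrite scaler_eq0 negb_or mulf_eq0 negb_or => /and3P[].
Qed.

End Polynomials.

(** * The intervals of the theorem, numbered from left to right *)

Section Intervals.

Variables (R : realType) (k l : nat) (b c : seq (\bar R)).

Lemma size_intervals : (1 <= k)%N -> (1 <= l)%N ->
  size (intervals k l b c) = (k + l)%N.
Proof.
move=> hk hl; rewrite /intervals !size_cat !size_map size_rev !size_iota /=.
by nlia.
Qed.

(** Here i counts the negative intervals outwards from 0, and list positions start at 0: position 2i
    holds c_(2i+1). The interval next to 0 has the end point 0 itself. *)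
Lemma nth_intervals_neg i : (i < l)%N ->
  nth (0%E, 0%E) (intervals k l b c) (l.-1 - i)
  = (c`_(2 * i), if i is j.+1 then c`_(2 * j).+1 else 0)%E.
Proof.
move=> il; rewrite nth_cat size_map size_rev size_iota.
case: i il => [|i] il; first by rewrite subn0 ltnn subnn.
have -> : (l.-1 - i.+1 < l.-1)%N by nlia.
rewrite (nth_map 0%N) ?size_rev ?size_iota; last by nlia.
rewrite nth_rev ?size_iota; last by nlia.
rewrite nth_iota; last by nlia.
have -> : (1 + (l.-1 - (l.-1 - i.+1).+1) = i.+1)%N by nlia.
by rewrite /elt mulnS.
Qed.

Lemma nth_intervals_pos i : (1 <= l)%N -> (i < k)%N ->
  nth (0%E, 0%E) (intervals k l b c) (l + i)
  = (if i is j.+1 then b`_(2 * j).+1 else 0, b`_(2 * i))%E.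
Proof.
move=> hl ik; rewrite nth_cat size_map size_rev size_iota.
have -> : (l + i < l.-1)%N = false by nlia.
have -> : (l + i - l.-1 = i.+1)%N by nlia.
case: i ik => [|i] ik //=; rewrite (nth_map 0%N) ?size_iota; last by nlia.
rewrite nth_iota; last by nlia.
by rewrite /elt add1n mulnS.
Qed.

End Intervals.

(** * Lines meeting the ellipsoid *)

Lemma conf_mx0_pos (R : realType) (k l : nat) (a : 'I_(k + l) -> R)
    (v : 'cV[R]_(k + l)) :
  confocal_constants a -> v != 0 -> 0 < dot (conf_mx a 0 *m v) v.
Proof.
move=> [a0 _] v0; rewrite conf_dotE.
have h i : 0 <= v i 0 * v i 0 / (a i - eps R i * 0).
  by rewrite mulr0 subr0 divr_ge0 -?expr2 ?sqr_ge0 ?(ltW (a0 i)).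
rewrite lt_neqAle sumr_ge0 // andbT eq_sym; apply: contra v0 => /eqP E.
apply/eqP/matrixP => i j; rewrite ord1 mxE.
have /eqP := psumr_eq0P (fun i _ => h i) E isT (i := i).
by rewrite mulr0 subr0 mulf_eq0 invr_eq0 (gt_eqF (a0 i)) orbF -expr2 sqrf_eq0 =>
  /eqP.
Qed.

Lemma conf_dot_line (R : realType) (k l : nat) (a : 'I_(k + l) -> R) lam
    (x v : 'cV[R]_(k + l)) t :
  let A := conf_mx a lam in
  dot (A *m (x + t *: v)) (x + t *: v)
  = dot (A *m x) x + 2 * t * dot (A *m x) v + t ^+ 2 * dot (A *m v) v.
Proof.
rewrite /= !conf_dotE !mulr_sumr -!big_split /=; apply: eq_bigr => i _.
rewrite !mxE; ring.
Qed.

(** Along the line the ellipsoid form is a quadratic with positive leading coefficient. It takes the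
    value 1 at some t, where the discriminant is the square (u + q t)^2; being non-zero, this is
    positive, so the minimum at t = - u / q is below 1. *)
Lemma intersects_inside (R : realType) (k l : nat) (a : 'I_(k + l) -> R)
    (x v : 'cV[R]_(k + l)) :
  confocal_constants a -> v != 0 -> intersects_ellipsoid a x v ->
  exists t, inside_ellipsoid a (x + t *: v).
Proof.
move=> ha /(conf_mx0_pos ha) v0 [[t]]; rewrite /on_ellipsoid /inside_ellipsoid.
rewrite /tangency_disc conf_dot_line.
set u := dot _ v; set w := dot _ x; move: v0; set q := dot _ _ => q0 E disc.
have disc0 : 0 < u ^+ 2 - q * (w - 1).
  rewrite lt_neqAle eq_sym disc -E.
  have -> : u ^+ 2 - q * (w - (w + 2 * t * u + t ^+ 2 * q)) = (u + q * t) ^+ 2.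
    by ring.
  exact: sqr_ge0.
exists (- u / q); rewrite conf_dot_line -/u -/w -/q.
have -> : w + 2 * (- u / q) * u + (- u / q) ^+ 2 * q = w - u ^+ 2 / q.
  by field; rewrite gt_eqF.
by rewrite ltrBlDr -ltrBlDl ltr_pdivlMr // mulrC; lra.
Qed.

Lemma tangency_disc_shift (R : realType) (k l : nat) (a : 'I_(k + l) -> R)
    (x v : 'cV[R]_(k + l)) t : confocal_constants a ->
  tangency_disc a (x + t *: v) v 0 = tangency_disc a x v 0.
Proof.
move=> [a0 _]; have h i : a i - eps R i * 0 != 0.
  by rewrite mulr0 subr0 gt_eqF.
by rewrite !tangency_polyE // tangency_poly_shift.
Qed.

(** The tangency polynomial does not change along the line, so a single root list [s] is interlaced
    with the roots lam of every inner point. *)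
Lemma line_interlacing (R : realType) (k l : nat) (hk : (1 <= k)%N)
    (hl : (1 <= l)%N) (a : 'I_(k + l) -> R) (ha : confocal_constants a)
    (x v : 'cV[R]_(k + l)) (hv : v != 0) (hE : intersects_ellipsoid a x v) :
  let p := nth 0 (points a) in
  let G := denom_sign R k l *: ('X * tangency_poly a x v) in
  let o := (0 < pseudo_dot v v) : nat in
  exists s, [/\ G != 0, sorted <=%R s,
    size s = ((k + l).-1 + (pseudo_dot v v != 0)%R)%N,
    G = lead_coef G *: \prod_(y <- s) ('X - y%:P) &
    forall t, inside_ellipsoid a (x + t *: v) ->
    exists lam, [/\ - denom_sign R k l *: containing_poly a (x + t *: v)
                    = linprod (k + l) lam,
      forall n, (n < k + l)%N -> p n <= lam n <= p n.+1,
      lam l.-1 < 0 < lam l &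
      forall i j, (i < k + l)%N -> (j < size s)%N ->
        ((i + o <= j)%N -> lam i <= s`_j) /\ ((j < i + o)%N -> s`_j <= lam i)]].
Proof.
move=> p G o.
have roots t : inside_ellipsoid a (x + t *: v) ->
    G != 0 /\ exists s lam, [/\ sorted <=%R s,
      size s = ((k + l).-1 + (pseudo_dot v v != 0)%R)%N,
      G = lead_coef G *: \prod_(y <- s) ('X - y%:P) &
      [/\ - denom_sign R k l *: containing_poly a (x + t *: v)
          = linprod (k + l) lam,
      forall n, (n < k + l)%N -> p n <= lam n <= p n.+1,
      lam l.-1 < 0 < lam l &
      forall i j, (i < k + l)%N -> (j < size s)%N ->
        ((i + o <= j)%N -> lam i <= s`_j) /\ ((j < i + o)%N -> s`_j <= lam i)]].
  move=> y_in; have [lam lamI FE] := containing_roots ha y_in.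
  have [||] := @touched_roots _ _ _ _ ha _ v lam _ y_in _ lamI FE.
    by rewrite addn_gt0 hk.
    by rewrite tangency_disc_shift //; case: hE.
  rewrite tangency_poly_shift -/G => G0 [s [ss sz sE sI]]; split=> //.
  exists s, lam; split=> //; split=> //.
  (* Since F(0) is non-zero inside the ellipsoid, the weak bounds by the point p l = 0 become
     strict. *)
  have lam0 n : (n < k + l)%N -> lam n != 0.
    move=> nd; apply/eqP => ln; have := containing_at_0 ha y_in.
    have : root (linprod (k + l) lam) 0 by apply/root_linprod; exists n.
    by rewrite FE rootE => /eqP ->; rewrite mulr0 ltxx.
  have l1d : (l.-1 < k + l)%N by nlia.
  have ld : (l < k + l)%N by nlia.
  rewrite !lt_neqAle lam0 // eq_sym lam0 //=.
  have [_] := andP (lamI _ l1d); have [+ _] := andP (lamI _ ld).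
  by rewrite prednK // nth_points_mid => -> ->.
have [t0 /roots [G0 [s [_ [ss sz sE _]]]]] := intersects_inside ha hv hE.
exists s; split=> // t /roots[_ [s' [lam [ss' _ sE' [? ? ? sI]]]]].
(* Both are sorted lists of the roots of the same polynomial. *)
suff -> : s = s' by exists lam.
apply: (sorted_eq le_trans le_anti) => //; apply: prod_XsubC_eq.
have lG : lead_coef G != 0 by rewrite lead_coef_eq0.
by apply: (scalerI lG); rewrite -sE.
Qed.

(** * The sequences b and c, built from poles and touched parameters *)

Section Assembly.

Variables (R : realType) (k l : nat) (a : 'I_(k + l) -> R).
Hypotheses (hk : (1 <= k)%N) (hl : (1 <= l)%N) (ha : confocal_constants a).

Local Notation p := (nth 0 (points a)).

Definition pos_poles : seq (\bar R) := [seq y%:E | y <- rev (take k (poles a))].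
Definition neg_poles : seq (\bar R) := [seq y%:E | y <- drop k (poles a)].
Lemma size_pos_poles : size pos_poles = k.
Proof. by rewrite size_map size_rev size_takel // size_poles leq_addr. Qed.

Lemma size_neg_poles : size neg_poles = l.
Proof. by rewrite size_map size_drop size_poles addKn. Qed.

Lemma nth_pos_poles i : (i < k)%N -> pos_poles`_i%E = (p (l.+1 + i))%:E.
Proof.
move=> ik; have sz := size_pos_poles; rewrite size_map in sz.
rewrite (nth_map 0) ?sz // nth_points_pos //; congr (_ %:E).
have sz' : size (take k (poles a)) = k by rewrite size_takel // size_poles leq_addr.
rewrite nth_rev sz' // nth_take; last by nlia.
by congr nth; nlia.
Qed.

Lemma nth_neg_poles i : (i < l)%N -> neg_poles`_i%E = (p (l.-1 - i))%:E.
Proof.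
move=> il; rewrite (nth_map 0) ?size_drop ?size_poles ?addKn //.
by rewrite nth_drop nth_points_neg.
Qed.

Variable lam : nat -> R.
Hypothesis lamI : forall n, (n < k + l)%N -> p n <= lam n <= p n.+1.
Let le_pts := points_le (points_increasing ha).

Lemma pos_poles_interlaced :
  interlaced (fun y z => y <= z)%E (fun i => (lam (l + i))%:E) k pos_poles 0%E.
Proof.
move=> i j ik; rewrite size_pos_poles => jk; rewrite nth_pos_poles //.
have id : (l + i < k + l)%N by nlia.
have [h1 h2] := andP (lamI id).
split=> ij; rewrite lee_fin.
  by apply: le_trans h2 (le_pts _); nlia.
by apply: le_trans (le_pts _) h1; nlia.
Qed.

Lemma neg_poles_interlaced :
  interlaced (fun y z => z <= y)%E (fun i => (lam (l.-1 - i))%:E) l neg_poles 0%E.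
Proof.
move=> i j il; rewrite size_neg_poles => jl; rewrite nth_neg_poles //.
have id : (l.-1 - i < k + l)%N by nlia.
have [h1 h2] := andP (lamI id).
split=> ij; rewrite lee_fin.
  by apply: le_trans (le_pts _) h1; nlia.
by apply: le_trans h2 (le_pts _); nlia.
Qed.

(* s lists the roots of 'X * tangency_poly in increasing order, its element of
   index l.-1 + o being the root 0; o is 1 for space-like lines, which have one
   more root below all the lam n, and inf counts the parameters +oo. *)
Variables (o : nat) (s : seq R) (inf : nat).
Hypotheses (o_le1 : (o <= 1)%N) (s_ge : ((k + l).-1 + o <= size s)%N).
Hypothesis s_le : (size s + inf <= k + l + o)%N.

Definition pos_params : seq (\bar R) :=
  [seq y%:E | y <- drop (l + o) s] ++ nseq inf (+oo)%E.
Definition neg_params : seq (\bar R) :=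
  [seq y%:E | y <- rev (take (l.-1 + o) s)].

Lemma size_pos_params : size pos_params = (size s - (l + o) + inf)%N.
Proof. by rewrite size_cat size_map size_drop size_nseq. Qed.

Lemma size_neg_params : size neg_params = (l.-1 + o)%N.
Proof. by rewrite size_map size_rev size_takel //; nlia. Qed.

Hypothesis lam_s : forall i j, (i < k + l)%N -> (j < size s)%N ->
  ((i + o <= j)%N -> lam i <= s`_j) /\ ((j < i + o)%N -> s`_j <= lam i).

Lemma pos_params_interlaced :
  interlaced (fun y z => y <= z)%E (fun i => (lam (l + i))%:E) k pos_params 0%E.
Proof.
move=> i j ik; rewrite size_pos_params => jk.
rewrite nth_cat size_map size_drop; case: ltnP => js.
  rewrite (nth_map 0) ?size_drop // nth_drop !lee_fin.
  have id : (l + i < k + l)%N by nlia.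
  have js' : (l + o + j < size s)%N by nlia.
  have [h1 h2] := lam_s id js'.
  by split=> ij; [apply: h1 | apply: h2]; nlia.
rewrite nth_nseq; split=> ij; last by nlia.
by have -> : (j - (size s - (l + o)) < inf)%N by [nlia]; rewrite leey.
Qed.

Lemma neg_params_interlaced :
  interlaced (fun y z => z <= y)%E (fun i => (lam (l.-1 - i))%:E) l neg_params 0%E.
Proof.
move=> i j il; rewrite size_neg_params => jl.
have sz : size (take (l.-1 + o) s) = (l.-1 + o)%N by rewrite size_takel //; nlia.
rewrite (nth_map 0) ?size_rev ?sz // nth_rev sz // nth_take; last by nlia.
have id : (l.-1 - i < k + l)%N by nlia.
have js : (l.-1 + o - j.+1 < size s)%N by nlia.
have [h1 h2] := lam_s id js.
by split=> ij; rewrite lee_fin; [apply: h2 | apply: h1]; nlia.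
Qed.

Definition pos_ends := interleave (fun y z => y <= z)%E pos_params pos_poles.
Definition neg_ends := interleave (fun y z => z <= y)%E neg_params neg_poles.

Lemma pos_total : total (fun y z : \bar R => y <= z)%E.
Proof. by move=> y z; apply: le_total. Qed.
Lemma neg_total : total (fun y z : \bar R => z <= y)%E.
Proof. by move=> y z; apply: le_total. Qed.
Lemma pos_trans : transitive (fun y z : \bar R => y <= z)%E.
Proof. exact: le_trans. Qed.
Lemma neg_trans : transitive (fun y z : \bar R => z <= y)%E.
Proof. by move=> y z t zy ty; apply: le_trans ty zy. Qed.

Lemma size_pos_pair :
  (size pos_params <= size pos_poles <= (size pos_params).+1)%N.
Proof. by rewrite size_pos_params size_pos_poles; nlia. Qed.

Lemma size_neg_pair :
  (size neg_params <= size neg_poles <= (size neg_params).+1)%N.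
Proof. by rewrite size_neg_params size_neg_poles; nlia. Qed.

(** The ends, other than 0, are the outer element of one pair and the inner element of the next pair
    away from 0. Each pair contains a pole, which confines the interval to [p n, p (n+1)], and lam n
    separates the two pairs. *)
Lemma interval_bounds n : (n < k + l)%N ->
  let I := nth (0%E, 0%E) (intervals k l pos_ends neg_ends) n in
  [/\ ((p n)%:E <= I.1)%E, (I.1 <= (lam n)%:E <= I.2)%E, (I.2 <= (p n.+1)%:E)%E &
      I.1 \in 0%E :: pos_ends ++ neg_ends /\ I.2 \in 0%E :: pos_ends ++ neg_ends].
Proof.
move=> nd /=.
pose Lp i := (lam (l + i))%:E; pose Ln i := (lam (l.-1 - i))%:E.
have [pp ps] : interlaced (fun y z => y <= z)%E Lp (size pos_poles) pos_poles 0%E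
    /\ interlaced (fun y z => y <= z)%E Lp (size pos_poles) pos_params 0%E.
  by rewrite size_pos_poles; split;
    [apply: pos_poles_interlaced | apply: pos_params_interlaced].
have [np ns] : interlaced (fun y z => z <= y)%E Ln (size neg_poles) neg_poles 0%E
    /\ interlaced (fun y z => z <= y)%E Ln (size neg_poles) neg_params 0%E.
  by rewrite size_neg_poles; split;
    [apply: neg_poles_interlaced | apply: neg_params_interlaced].
have szb : size pos_ends = (size pos_params + k)%N.
  by rewrite size_interleave size_pos_poles.
have szc : size neg_ends = (size neg_params + l)%N.
  by rewrite size_interleave size_neg_poles.
have sp := size_pos_pair; have sn := size_neg_pair.
rewrite size_pos_poles in sp; rewrite size_neg_poles in sn.
have memb i : (i < size pos_ends)%N ->
    pos_ends`_i%E \in 0%E :: pos_ends ++ neg_ends.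
  by move=> ib; rewrite inE mem_cat mem_nth // orbT.
have memc i : (i < size neg_ends)%N ->
    neg_ends`_i%E \in 0%E :: pos_ends ++ neg_ends.
  by move=> ib; rewrite inE mem_cat [X in _ || (_ || X)]mem_nth // !orbT.
have mem0 : 0%E \in 0%E :: pos_ends ++ neg_ends by rewrite inE eqxx.
case: (ltnP n l) => nl.
  have [i nE il] : exists2 i, n = (l.-1 - i)%N & (i < l)%N.
    by exists (l.-1 - n)%N; nlia.
  rewrite nE nth_intervals_neg //=.
  have ie : (i < size neg_poles)%N by rewrite size_neg_poles.
  have e1 := interleave_even_le 0%E neg_total size_neg_pair ie.
  have e2 : (neg_ends`_(2 * i) <= (lam (l.-1 - i))%:E)%E :=
    interleave_even_ge size_neg_pair ns np ie.
  split; first by rewrite -nth_neg_poles.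
  - rewrite e2 /=; case: i ie {nE e1 e2 nl nd} il => [|i] ie il.
      rewrite subn0 lee_fin; have l1d : (l.-1 < k + l)%N by nlia.
      by have [_] := andP (lamI l1d); rewrite prednK // nth_points_mid.
    exact: (interleave_odd_le size_neg_pair ns np ie).
  - case: i ie {nE e1 e2 nl nd} il => [|i] ie il.
      by rewrite subn0 prednK // nth_points_mid.
    have is' : (i < size neg_params)%N by nlia.
    have -> : ((l.-1 - i.+1).+1 = l.-1 - i)%N by nlia.
    rewrite -nth_neg_poles; last by nlia.
    exact: (interleave_odd_ge 0%E neg_total size_neg_pair is').
  split; first by apply: memc; nlia.
  by case: i ie {nE e1 e2 nl nd} il => [|i] ie il //; apply: memc; nlia.
have [i nE ik] : exists2 i, n = (l + i)%N & (i < k)%N.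
  by exists (n - l)%N; nlia.
rewrite nE nth_intervals_pos //=.
have ie : (i < size pos_poles)%N by rewrite size_pos_poles.
have e1 := interleave_even_le 0%E pos_total size_pos_pair ie.
have e2 : ((lam (l + i))%:E <= pos_ends`_(2 * i))%E :=
  interleave_even_ge size_pos_pair ps pp ie.
split.
- case: i ie {nE e1 e2 nl nd} ik => [|i] ie ik.
    by rewrite addn0 nth_points_mid.
  have is' : (i < size pos_params)%N by nlia.
  have -> : (l + i.+1 = l.+1 + i)%N by nlia.
  rewrite -nth_pos_poles; last by nlia.
  exact: (interleave_odd_ge 0%E pos_total size_pos_pair is').
- rewrite [X in _ && X]e2 andbT; case: i ie {nE e1 e2 nl nd} ik => [|i] ie ik.
    rewrite addn0 lee_fin; have ld : (l < k + l)%N by nlia.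
    by have [+ _] := andP (lamI ld); rewrite nth_points_mid.
  exact: (interleave_odd_le size_pos_pair ps pp ie).
- by rewrite -addSn -nth_pos_poles.
split; last by apply: memb; nlia.
by case: i ie {nE e1 e2 nl nd} ik => [|i] ie ik //; apply: memb; nlia.
Qed.

End Assembly.

Lemma elt_interleave (R : realType) (leT : rel (\bar R)) (s e : seq (\bar R)) i :
  (size s <= size e <= (size s).+1)%N -> (1 <= i <= size s)%N ->
  elt s i \in [:: elt (interleave leT s e) (2 * i - 1);
                  elt (interleave leT s e) (2 * i)].
Proof.
move=> sz; case: i => [//|i] /= si.
have := mem_interleave leT 0%E sz si.
have -> : (2 * i.+1 - 1 = (2 * i).+1)%N by nlia.
by have -> : (2 * i.+1 = (2 * i).+2)%N by nlia.
Qed.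

(** Elements of index at least l + o are >= lam l > 0, and those of index below l - 1 + o are <= lam
    (l-1) < 0; a single index remains for 0. *)
Lemma pos_at_root (R : realType) (k l : nat) (hk : (1 <= k)%N) (hl : (1 <= l)%N)
    (o : nat) (s : seq R) (lam : nat -> R) :
    lam l.-1 < 0 < lam l ->
    (forall i j, (i < k + l)%N -> (j < size s)%N ->
        ((i + o <= j)%N -> lam i <= s`_j) /\ ((j < i + o)%N -> s`_j <= lam i)) ->
    0 \in s -> (l.-1 + o < size s)%N /\ s`_(l.-1 + o) = 0.
Proof.
move=> /andP[ll lr] lam_s /(nthP 0)[j js s0].
have ld : (l < k + l)%N by nlia.
have l1d : (l.-1 < k + l)%N by nlia.
suff jE : j = (l.-1 + o)%N by rewrite -jE.
have [h1 _] := lam_s _ _ ld js; have [_ h2] := lam_s _ _ l1d js.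
have [/h1|jl] := leqP (l + o) j; first by rewrite s0 leNgt lr.
have [/h2|jl'] := ltnP j (l.-1 + o); first by rewrite s0 leNgt ll.
by nlia.
Qed.

(** Removing from [s] the root 0, which belongs to the factor ['X] of G, leaves the roots of the
    tangency polynomial. They fall short of the formal degree by one exactly when [e] holds, and +oo
    fills the gap. *)
Lemma touched_parameters_split (R : realType) (k l : nat) (hk : (1 <= k)%N)
    (hl : (1 <= l)%N) (a : 'I_(k + l) -> R) (x v : 'cV[R]_(k + l))
    (o : nat) (s : seq R) (e : bool) :
    let G := denom_sign R k l *: ('X * tangency_poly a x v) in
    G != 0 -> G = lead_coef G *: \prod_(y <- s) ('X - y%:P) ->
    size s = ((k + l).-1 + ~~ e)%N -> (l.-1 + o < size s)%N -> s`_(l.-1 + o) = 0 ->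
  touched_parameters a x v (pos_params l o s e ++ neg_params l o s).
Proof.
move=> G G0 GE sz zs s0; set P := tangency_poly a x v.
have P0 : P != 0.
  by move: G0; rewrite scaler_eq0 negb_or mulf_eq0 negb_or => /and3P[].
have E1 : (l.-1 + o).+1 = (l + o)%N by nlia.
exists (drop (l + o) s ++ rev (take (l.-1 + o) s)); split=> //.
  have k0 := denom_sign_neq0 R k l.
  have sE : perm_eq s (0 :: drop (l + o) s ++ rev (take (l.-1 + o) s)).
    rewrite -{1}[s](cat_take_drop (l.-1 + o)) (drop_nth 0) // s0 E1.
    rewrite perm_catC /= perm_cons perm_cat2l perm_sym; exact/permPl/perm_rev.
  have lG : lead_coef G = denom_sign R k l * lead_coef P.
    by rewrite lead_coefZ ['X * _]mulrC lead_coefMX.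
  have X0 : 'X != 0 :> {poly R} by rewrite polyX_eq0.
  apply: (mulfI X0); apply: (scalerI k0); rewrite [LHS]GE lG -scalerA.
  by rewrite (perm_big _ sE) /= big_cons subr0 scalerAr.
rewrite /pos_params /neg_params map_cat -!catA perm_cat2l perm_catC perm_cat2l.
rewrite size_cat size_drop size_rev size_takel 1?ltnW //.
by rewrite (_ : (_ - _)%N = e) //; move: sz; case: (e) => /= sz; nlia.
Qed.

Lemma perm_ends (R : realType) (k l : nat) (a : 'I_(k + l) -> R)
    (o inf : nat) (s : seq R) :
  perm_eq (pos_ends a o s inf ++ neg_ends a o s)
    ([seq (eps R i * a i)%:E | i <- enum 'I_(k + l)]
       ++ (pos_params l o s inf ++ neg_params l o s)).
Proof.
have -> : [seq (eps R i * a i)%:E | i <- enum 'I_(k + l)]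
          = [seq y%:E | y <- take k (poles a)] ++ neg_poles a.
  by rewrite /neg_poles -map_cat cat_take_drop /poles -map_comp.
apply/permP => Q; rewrite !count_cat.
rewrite (permP (perm_interleave _ _ _)) (permP (perm_interleave _ _ _)) !count_cat.
by rewrite /pos_poles map_rev count_rev; nlia.
Qed.

(** Equal neighbours would coincide with the point between them. That point is not 0, which
    separates lam (l-1) from lam l strictly, so it is a pole and F would have multiplicity at least
    2 there. *)
Lemma linprod_strict (R : realType) (k l : nat) (hk : (1 <= k)%N)
    (hl : (1 <= l)%N) (a : 'I_(k + l) -> R) (F : {poly R}) (lam : nat -> R) :
    (forall n, (n < k + l)%N -> (points a)`_n <= lam n <= (points a)`_n.+1) ->
    lam l.-1 < 0 < lam l -> F != 0 ->
    F = lead_coef F *: linprod (k + l) lam ->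
    (forall i, (mup (eps R i * a i) F <= 1)%N) ->
  forall n, (n.+1 < k + l)%N -> lam n < lam n.+1.
Proof.
move=> lamI lam0 F0 FE Fmup n nd; have nd' := ltnW nd.
have [_ h1] := andP (lamI _ nd'); have [h2 _] := andP (lamI _ nd).
rewrite lt_neqAle (le_trans h1 h2) andbT; apply/eqP => lamE.
have pE : (points a)`_n.+1 = lam n by apply/eqP; rewrite eq_le h1 lamE h2.
have [nl|[i [pi _]]] := point_sign a nd'.
  move: lam0; have -> : l.-1 = n by nlia.
  by rewrite -nl -lamE => /andP[h /ltW]; rewrite leNgt h.
have := Fmup i; rewrite -[eps R i * a i]/(pole a i) -pi pE leqNgt mup_geq //.
case/negP; rewrite FE dvdpZr ?lead_coef_eq0 //.
rewrite (@linprod_bump _ _ lam n) // (@linprod_bump _ _ _ n); last by nlia.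
rewrite /bump leqnn add1n -lamE mulrA -expr2; exact: dvdp_mulr.
Qed.

(** The n-th interval contains lam n, strictly as soon as no root of F is an end point. Any root lam
    m with m different from n lies beyond p n or p (n+1), hence outside the open interval. *)
Lemma containing_parameters (R : realType) (k l : nat) (hk : (1 <= k)%N)
    (hl : (1 <= l)%N) (a : 'I_(k + l) -> R) (F : {poly R}) (lam : nat -> R)
    (b c : seq (\bar R)) :
    (forall n, (n < k + l)%N -> (points a)`_n <= lam n <= (points a)`_n.+1) ->
    (forall i j, (i <= j <= k + l)%N -> (points a)`_i <= (points a)`_j) ->
    lam l.-1 < 0 < lam l -> F != 0 -> ~~ root F 0 ->
    F = lead_coef F *: linprod (k + l) lam ->
    (forall n, (n < k + l)%N ->
       let I := nth (0%E, 0%E) (intervals k l b c) n in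
       [/\ (((points a)`_n)%:E <= I.1)%E, (I.1 <= (lam n)%:E <= I.2)%E,
           (I.2 <= ((points a)`_n.+1)%:E)%E &
           I.1 \in 0%E :: b ++ c /\ I.2 \in 0%E :: b ++ c]) ->
  (exists r : seq R,
     size r = (k + l)%N /\
     F = lead_coef F *: \prod_(z <- r) ('X - z%:P) /\
     (forall n : nat, (n < k + l)%N ->
        let I := nth (0%E, 0%E) (intervals k l b c) n in
        (I.1 <= (nth 0 r n)%:E <= I.2)%E)) /\
  ((forall i : 'I_(k + l), (mup (eps R i * a i) F <= 1)%N) ->
     exists s : seq R,
       uniq s /\ size s = (k + l)%N /\
       (forall lam : R, root F lam = (lam \in s))) /\
  ((forall lam : R, root F lam -> lam%:E \notin b ++ c) ->
     forall I : \bar R * \bar R, I \in intervals k l b c ->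
     exists! lam : R, root F lam /\ (I.1 < lam%:E < I.2)%E).
Proof.
move=> lamI p_le lam0 F0 F00 FE bounds.
have rootF z : root F z = root (linprod (k + l) lam) z.
  by rewrite FE rootZ ?lead_coef_eq0.
split; [|split].
- exists (mkseq lam (k + l)); rewrite size_mkseq -linprodE; split=> //; split=> //.
  by move=> n nd; rewrite nth_mkseq //; case: (bounds n nd).
- move=> Fmup; exists (mkseq lam (k + l)); rewrite size_mkseq; split.
    apply: (sorted_uniq lt_trans ltxx); apply/(sortedP 0) => i.
    rewrite size_mkseq => id; rewrite !nth_mkseq //; last exact: ltnW.
    exact: (linprod_strict hk hl lamI lam0 F0 FE Fmup id).
  split=> // z; rewrite rootF; apply/root_linprod/mapP.
    by case=> i id ->; exists i; rewrite ?mem_iota.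
  by case=> i; rewrite mem_iota => id ->; exists i.
move=> Fnot I /(nthP (0%E, 0%E))[n]; rewrite size_intervals // => nd IE.
have [pI lamJ Ip [m1 m2]] := bounds n nd; rewrite IE in pI lamJ Ip m1 m2.
have Flam : root F (lam n) by rewrite rootF; apply/root_linprod; exists n.
have neq y : y \in 0%E :: b ++ c -> (lam n)%:E != y.
  move=> yb; apply: contraTneq yb => <-; rewrite inE negb_or Fnot // andbT.
  by rewrite eqe; apply: contraNneq F00 => <-.
exists (lam n); split.
  split=> //; have [h1 h2] := andP lamJ.
  by rewrite !lt_neqAle h1 h2 eq_sym !neq.
move=> z [Fz /andP[z1 z2]]; move: Fz; rewrite rootF => /root_linprod[m md zE].
have [h1 h2] := andP (lamI m md).
have [mn|nm|mn] := ltngtP m n; last by rewrite zE mn.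
  have := le_lt_trans pI z1; rewrite lte_fin zE ltNge.
  by rewrite (le_trans h2) //; apply: p_le; nlia.
have := lt_le_trans z2 Ip; rewrite lte_fin zE ltNge.
by rewrite (le_trans _ h1) //; apply: p_le; nlia.
Qed.

(** * The three types of line, and the quadrics through an inner point *)

Theorem theorem2p3 (R : realType) (k l : nat) (hk : (1 <= k)%N) (hl : (1 <= l)%N)
    (a : 'I_(k + l) -> R) (ha : confocal_constants a)
    (x v : 'cV[R]_(k + l)) (hv : v != 0) (hE : intersects_ellipsoid a x v) :
  exists alpha b c : seq (\bar R),
    size alpha = (k + l).-1 /\
    touched_parameters a x v alpha /\
    perm_eq (b ++ c) ([seq (eps R i * a i)%:E | i <- enum 'I_(k + l)] ++ alpha) /\
    sorted (fun y z => y <= z)%E b /\ all (fun z => 0 < z)%E b /\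
    sorted (fun y z => z <= y)%E c /\ all (fun z => z < 0)%E c /\
    (size b + size c = 2 * (k + l) - 1)%N /\
    (space_like v ->
       size b = (2 * k - 1)%N /\ size c = (2 * l)%N /\
       (forall i : 'I_(k + l), i = 0%N :> nat -> elt b (size b) = (a i)%:E) /\
       (forall i : nat, (1 <= i <= k - 1)%N ->
          elt alpha i \in [:: elt b (2 * i - 1)%N; elt b (2 * i)%N]) /\
       (forall j : nat, (1 <= j <= l)%N ->
          elt alpha (j + k - 1)%N \in [:: elt c (2 * j - 1)%N; elt c (2 * j)%N])) /\
    (time_like v ->
       size b = (2 * k)%N /\ size c = (2 * l - 1)%N /\
       (forall i : 'I_(k + l), i = (k + l).-1 :> nat ->
          elt c (size c) = (- a i)%:E) /\
       (forall i : nat, (1 <= i <= k)%N ->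
          elt alpha i \in [:: elt b (2 * i - 1)%N; elt b (2 * i)%N]) /\
       (forall j : nat, (1 <= j <= l - 1)%N ->
          elt alpha (j + k)%N \in [:: elt c (2 * j - 1)%N; elt c (2 * j)%N])) /\
    (light_like v ->
       size b = (2 * k)%N /\ size c = (2 * l - 1)%N /\
       elt b (size b) = (+oo)%E /\ elt alpha k = (+oo)%E /\
       (forall i : 'I_(k + l), i = 0%N :> nat ->
          elt b (size b - 1)%N = (a i)%:E) /\
       (forall i : nat, (1 <= i <= k - 1)%N ->
          elt alpha i \in [:: elt b (2 * i - 1)%N; elt b (2 * i)%N]) /\
       (forall j : nat, (1 <= j <= l - 1)%N ->
          elt alpha (j + k)%N \in [:: elt c (2 * j - 1)%N; elt c (2 * j)%N])) /\
    (forall t : R, inside_ellipsoid a (x + t *: v) ->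
       let F := containing_poly a (x + t *: v) in
       (exists r : seq R,
          size r = (k + l)%N /\
          F = lead_coef F *: \prod_(z <- r) ('X - z%:P) /\
          (forall n : nat, (n < k + l)%N ->
             let I := nth (0%E, 0%E) (intervals k l b c) n in
             (I.1 <= (nth 0 r n)%:E <= I.2)%E)) /\
       ((forall i : 'I_(k + l), (mup (eps R i * a i) F <= 1)%N) ->
          exists s : seq R,
            uniq s /\ size s = (k + l)%N /\
            (forall lam : R, root F lam = (lam \in s))) /\
       ((forall lam : R, root F lam -> lam%:E \notin b ++ c) ->
          forall I : \bar R * \bar R, I \in intervals k l b c ->
          exists! lam : R, root F lam /\ (I.1 < lam%:E < I.2)%E)).
Proof.
have [s [G0 ss sz GE lineE]] := line_interlacing hk hl ha hv hE.
set q := pseudo_dot v v in sz lineE; set o : nat := (0 < q)%R in lineE.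
pose e := q == 0; pose inf : nat := e.
(* The three flags stand for space-like, light-like and time-like; exactly one of them is 1. *)
have oe : (o + e + (q < 0)%R = 1)%N by rewrite /o /e; case: ltgtP.
have {}sz : size s = ((k + l).-1 + ~~ e)%N by rewrite sz.
(* One inner point is enough to establish the order and pairing of b and c, which do not depend on
   it. *)
have [t0 y0_in] := intersects_inside ha hv hE.
have [lam0 [_ lam0I lam0l lam0s]] := lineE t0 y0_in.
have s0 : 0 \in s.
  rewrite -root_prod_XsubC.
  have := rootM ('X) (tangency_poly a x v) 0; rewrite rootX eqxx /= => X0.
  have lG : lead_coef (denom_sign R k l *: ('X * tangency_poly a x v)) != 0.
    by rewrite lead_coef_eq0.
  by rewrite -(rootZ _ _ lG) -GE rootZ ?denom_sign_neq0.
have [zs sz0] := pos_at_root hk hl lam0l lam0s s0.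
have o_le1 : (o <= 1)%N by rewrite /o; case: (_ < _).
have s_ge : ((k + l).-1 + o <= size s)%N by rewrite sz; move: oe; rewrite /e; nlia.
have s_le : (size s + inf <= k + l + o)%N by rewrite sz /inf; case: (e); nlia.
pose pa := pos_params l o s inf; pose na := neg_params l o s.
pose b := pos_ends a o s inf; pose c := neg_ends a o s.
have spp : size (pos_poles a) = k := size_pos_poles a.
have snp : size (neg_poles a) = l := size_neg_poles a.
have spa : size pa = (size s - (l + o) + inf)%N := size_pos_params l o s inf.
have sna : size na = (l.-1 + o)%N := size_neg_params hk hl o_le1 s_ge s_le.
have szb : size b = (size pa + k)%N by rewrite size_interleave spp.
have szc : size c = (size na + l)%N by rewrite size_interleave snp.
have pairp := size_pos_pair a hk hl o_le1 s_ge s_le.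
have pairn := size_neg_pair a hk hl o_le1 s_ge s_le.
pose Lp i := (lam0 (l + i)%N)%:E; pose Ln i := (lam0 (l.-1 - i)%N)%:E.
have [pp ps] : interlaced (fun y z => y <= z)%E Lp (size (pos_poles a)) (pos_poles a) 0%E
    /\ interlaced (fun y z => y <= z)%E Lp (size (pos_poles a)) pa 0%E.
  rewrite spp; split; first exact: (pos_poles_interlaced hk hl ha lam0I).
  exact: (pos_params_interlaced hk hl o_le1 s_ge s_le lam0s).
have [np ns] : interlaced (fun y z => z <= y)%E Ln (size (neg_poles a)) (neg_poles a) 0%E
    /\ interlaced (fun y z => z <= y)%E Ln (size (neg_poles a)) na 0%E.
  rewrite snp; split; first exact: (neg_poles_interlaced hk hl ha lam0I).
  exact: (neg_params_interlaced hk hl o_le1 s_ge s_le lam0s).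
have [lamn lamp] := andP lam0l.
have eltb i : (1 <= i <= size pa)%N ->
    elt (pa ++ na) i \in [:: elt b (2 * i - 1)%N; elt b (2 * i)%N].
  move=> ipa; rewrite (_ : elt _ i = elt pa i); first exact: elt_interleave.
  by rewrite /elt nth_cat; have -> : (i.-1 < size pa)%N by nlia.
have eltc j : (1 <= j <= size na)%N ->
    elt (pa ++ na) (j + size pa) \in [:: elt c (2 * j - 1)%N; elt c (2 * j)%N].
  move=> jna; rewrite (_ : elt _ _ = elt na j); first exact: elt_interleave.
  rewrite /elt nth_cat; have -> : ((j + size pa).-1 < size pa)%N = false by nlia.
  by congr nth; case: j jna => // j _; rewrite addSn /= addnK.
have lastb : (pos_poles a)`_k.-1%E = (a (Ordinal (ltn_addr l hk)))%:E.
  rewrite nth_pos_poles //; last by nlia.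
  rewrite nth_points_pos //; last by nlia.
  rewrite subnn (nth_poles a (Ordinal (ltn_addr l hk))) /pole /eps /=.
  by rewrite hk mul1r.
(* The parameters are numbered with the positive ones first, upwards, and then the negative ones,
   downwards, as the pairing clauses require. *)
exists (pa ++ na); exists b; exists c.
split; first by rewrite size_cat spa sna sz /inf; move: oe; case: (e); nlia.
split; first exact: touched_parameters_split hk hl a x v o s e G0 GE sz zs sz0.
split; first exact: perm_ends.
split; first exact: (sorted_interleave (@pos_total R) (@pos_trans R) pairp ps pp).
split.
  apply: sub_all (all_interleave_ge pairp ps pp) => z; apply: lt_le_trans.
  by rewrite /Lp addn0 lte_fin.
split; first exact: (sorted_interleave (@neg_total R) (@neg_trans R) pairn ns np).
split.
  apply: sub_all (all_interleave_ge pairn ns np) => z /le_lt_trans; apply.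
  by rewrite /Ln subn0 lte_fin.
split; first by rewrite szb szc spa sna sz /inf; move: oe; case: (e); nlia.
(* A space-like line touches only k - 1 quadrics with positive parameter; for the other two types
   there are k, +oo included. *)
have size_e : (size pa = k.-1 + (e || (q < 0)%R))%N.
  by rewrite spa sz /inf; move: oe; case: (e); case: (_ < 0) => /=; nlia.
split; [|split; [|split]].
- rewrite /space_like -/q => q0.
  have o1 : o = 1%N by rewrite /o q0.
  have spa' : size pa = k.-1 by rewrite size_e /e gt_eqF // ltNge ltW //= addn0.
  split; first by rewrite szb spa'; nlia.
  split; first by rewrite szc sna o1; nlia.
  split; [|split].
  + move=> i i0; have -> : i = Ordinal (ltn_addr l hk) by apply: val_inj.
    rewrite -lastb /elt szb spa'.
    (* There is one pole more than there are positive parameters, so the largest pole a_1 has no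
       partner and ends b. *)
    have -> : (k.-1 + k).-1 = (2 * size pa)%N by rewrite spa'; nlia.
    by rewrite nth_interleave_last ?spa' // spp; nlia.
  + by move=> i ik; apply: eltb; rewrite spa'; nlia.
  + move=> j jl; have -> : (j + k - 1 = j + size pa)%N by rewrite spa'; nlia.
    by apply: eltc; rewrite sna o1; nlia.
- rewrite /time_like -/q => q0.
  have o0 : o = 0%N by rewrite /o ltNge ltW.
  have spa' : size pa = k by rewrite size_e q0 orbT; nlia.
  split; first by rewrite szb spa'; nlia.
  split; first by rewrite szc sna o0; nlia.
  split; [|split].
  + move=> i iE; rewrite /elt szc sna o0 addn0.
    (* On the negative side it is now the smallest pole that has no partner and ends c. *)
    have -> : (l.-1 + l).-1 = (2 * size na)%N by rewrite sna o0; nlia.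
    rewrite nth_interleave_last ?snp ?sna ?o0 ?addn0; last by nlia.
    rewrite (nth_map 0) ?size_drop ?size_poles ?addKn; last by nlia.
    rewrite nth_drop; have -> : (k + l.-1 = i)%N by rewrite iE; nlia.
    rewrite nth_poles /pole /eps; have -> : (i < k)%N = false by nlia.
    by rewrite mulN1r.
  + by move=> i ik; apply: eltb; rewrite spa'; nlia.
  + move=> j jl; rewrite -{1}spa'.
    by apply: eltc; rewrite sna o0; nlia.
- rewrite /light_like -/q => q0.
  have o0 : o = 0%N by rewrite /o q0 ltxx.
  have e1 : e by rewrite /e q0.
  have spa' : size pa = k by rewrite size_e e1; nlia.
  have pa_inf : pa`_k.-1%E = +oo%E.
    rewrite /pa /pos_params nth_cat size_map size_drop sz e1 o0.
    have -> : (k.-1 < (k + l).-1 + ~~ true - (l + 0))%N = false by nlia.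
    by rewrite /inf e1 nth_nseq; case: ifP => //; nlia.
  (* The last pair of b is {+oo, a_1}; the comparison puts a_1 first. *)
  have [||be bo] := @nth_interleave _ (fun y z => y <= z)%E 0%E pa (pos_poles a) k.-1.
  + by rewrite spa'; nlia.
  + by rewrite spp; nlia.
  rewrite pa_inf lastb leye_eq /= in be bo.
  split; first by rewrite szb spa'; nlia.
  split; first by rewrite szc sna o0; nlia.
  split; [|split; [|split; [|split]]].
  + by rewrite /elt szb spa' -bo; congr nth; nlia.
  + rewrite /elt nth_cat spa'; have -> : (k.-1 < k)%N by nlia.
    exact: pa_inf.
  + move=> i i0; have -> : i = Ordinal (ltn_addr l hk) by apply: val_inj.
    by rewrite /elt szb spa' -be; congr nth; nlia.
  + by move=> i ik; apply: eltb; rewrite spa'; nlia.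
  + move=> j jl; rewrite -{1}spa'.
    by apply: eltc; rewrite sna o0; nlia.
move=> t y_in F; have [lam [FE lamI laml lams]] := lineE t y_in.
have k0 := denom_sign_neq0 R k l.
have F0 : F != 0.
  apply: contraTneq (monic_neq0 (monic_linprod (k + l) lam)) => F0.
  by rewrite -FE -/F F0 scaler0 eqxx.
(* The normalizing factor has square 1, so multiplying by it again recovers F. *)
have FE' : F = lead_coef F *: linprod (k + l) lam.
  apply: (@split_linprod _ _ _ (- denom_sign R k l)%:P).
    rewrite mul_polyC -FE scalerA mulrNN denom_sign_sqr scale1r //.
  have := size_normalized_containing a (x + t *: v).
  by rewrite size_scale ?oppr_eq0 // => ->.
apply: (containing_parameters hk hl lamI _ laml F0 _ FE').
- by move=> i j ij; apply: (points_le (points_increasing ha)).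
- have := containing_at_0 ha y_in; rewrite rootE; apply: contraTneq => F00.
  by rewrite hornerZ -/F F00 !mulr0 ltxx.
- exact: interval_bounds.
Qed.
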